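(* Let $\varphi:\mathbb{D}\to[0,\infty)$ be a function and let $C\ge 2$. If there is a function $u:\mathbb{D}\to(0,\infty)$ which is superharmonic on $\mathbb{D}$, Log-Lipschitz with constant $C$, and satisfies $u\ge\varphi$ on $\mathbb{D}$, then $\varphi$ admits a harmonic majorant, i.e. there is a positive harmonic function $h$ on $\mathbb{D}$ with $h\ge\varphi$ on $\mathbb{D}$.
   Context: $\mathbb{D}$ is the open unit disk in $\mathbb{C}$. Pseudohyperbolic distance: $d(z,w)=\left|\frac{z-w}{1-z\overline{w}}\right|$; hyperbolic distance: $\rho(z,w)=\frac12\log\frac{1+d(z,w)}{1-d(z,w)}$. A positive-valued function $F$ on $\mathbb{D}$ is Log-Lipschitz with constant $C$ if $|\log F(z)-\log F(w)|\le C\rho(z,w)$ for all $z,w\in\mathbb{D}$. *)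

(* Defs.v *)
From HB Require Import structures.
From mathcomp Require Import all_boot all_order all_algebra.
From mathcomp Require Import complex.
From mathcomp Require Import all_classical all_reals all_analysis.

Set Implicit Arguments.
Unset Strict Implicit.
Unset Printing Implicit Defensive.

Import Order.TTheory GRing.Theory Num.Theory.
Import numFieldNormedType.Exports.

Local Open Scope classical_set_scope.
Local Open Scope complex_scope.
Local Open Scope ring_scope.

(* Functions on a subset of the complex plane are represented by total functions
   on R[i]; the definitions below only constrain their values on that subset.
   The alias R[i]^o carries the usual topology of the complex plane. *)

Definition unit_disk (R : realType) : set R[i] := [set z | `|z| < 1].

(* Normc.normc is the modulus with values in R, whereas `|z| is in R[i]. *)
Definition pseudohyp_dist (R : realType) (z w : R[i]) : R :=
  Normc.normc ((z - w) / (1 - z * w^*%C)).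

Definition hyp_dist (R : realType) (z w : R[i]) : R :=
  2^-1 * ln ((1 + pseudohyp_dist z w) / (1 - pseudohyp_dist z w)).

(* Meant for F positive on the disk: ln is 0 on nonpositive arguments. *)
Definition log_lipschitz (R : realType) (C : R) (F : R[i] -> R) : Prop :=
  forall z w : R[i], unit_disk z -> unit_disk w ->
    `|ln (F z) - ln (F w)| <= C * hyp_dist z w.

Definition circle_pt (R : realType) (z : R[i]) (r t : R) : R[i] :=
  z + r%:C * (cos t +i* sin t).

Definition circle_mean (R : realType) (f : R[i] -> \bar R) (z : R[i]) (r : R)
    : \bar R :=
  (((2 * pi)^-1)%R%:E *
   \int[@lebesgue_measure R]_(t in `[0%R, (2 * pi)%R]) f (circle_pt z r t))%E.

(* Superharmonicity on a domain (nonempty connected open set) D: lower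
   semicontinuous, > -oo, not identically +oo, and at least its mean over every
   circle bounding a closed disk contained in D. The lower semicontinuity and
   the bound > -oo make the integrals in the circle means well defined. *)
Definition superharmonic_on (R : realType) (D : set R[i]) (f : R[i] -> \bar R)
    : Prop :=
  [/\ forall (z : R[i]) (a : R), D z -> (a%:E < f z)%E ->
        \forall w \near (z : R[i]^o), (a%:E < f w)%E,
      forall z : R[i], D z -> (-oo < f z)%E,
      exists2 z : R[i], D z & (f z < +oo)%E
    & forall (z : R[i]) (r : R), 0 < r ->
        [set w | `|w - z| <= r%:C] `<=` D -> (circle_mean f z r <= f z)%E].

Definition partial_x (R : realType) (f : R[i] -> R) (z : R[i]) : R :=
  derive1 (fun s : R => f (s +i* complex.Im z)) (complex.Re z).

Definition partial_y (R : realType) (f : R[i] -> R) (z : R[i]) : R :=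
  derive1 (fun s : R => f (complex.Re z +i* s)) (complex.Im z).

(* The derivability clauses are needed: derive1 is total and returns a junk value
   at points where the derivative does not exist. *)
Definition C1_on (R : realType) (D : set R[i]) (f : R[i] -> R) : Prop :=
  forall z : R[i], D z ->
    [/\ derivable (fun s : R => f (s +i* complex.Im z)) (complex.Re z) 1,
        derivable (fun s : R => f (complex.Re z +i* s)) (complex.Im z) 1,
        {for z, continuous (partial_x f : R[i]^o -> R)}
      & {for z, continuous (partial_y f : R[i]^o -> R)}].

Definition C2_on (R : realType) (D : set R[i]) (f : R[i] -> R) : Prop :=
  [/\ C1_on D f, C1_on D (partial_x f) & C1_on D (partial_y f)].

Definition harmonic_on (R : realType) (D : set R[i]) (h : R[i] -> R) : Prop :=
  C2_on D h /\
  forall z : R[i], D z ->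
    partial_x (partial_x h) z + partial_y (partial_y h) z = 0.

(* Main.v *)
(* A positive superharmonic function u that is Log-Lipschitz is dominated by the
   balayage of its Riesz mass, pushed outwards from a dyadic circle to the unit
   circle.  Everything can be done with real parts of polynomials, without
   Poisson integrals or Riesz measures.

   Let r_n = 1 - 2^-(n+1).  By Fejer approximation there are harmonic
   polynomials v_n with u + 2^-(n+1) <= v_n <= u + 2^-n on |z| = r_n.  The
   minimum principle gives v_n <= u + 2^-n on |z| <= r_n, so that
   g_n = v_n - v_(n+1) >= 0 there.  Dilating each piece to the unit disk, set
     H_N(z) = v_N(r_N z) + sum_(n < N) g_n(r_n z),
   which is nonnegative on the closed unit disk and has H_N(0) = v_0(0) <= u(0) + 1.
   If 1 - |z| ~ 2^-m and k = m + 2, then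
   - v_k(z) = v_N(z) + sum_(k <= n < N) g_n(z) <= 3 H_N(z), by Harnack's
     inequality between z and r_n z in the disk |w| <= r_n;
   - u(z) <= K v_k(z), because v_k >= u on the circle |w| = r_k and
     u >= u(z) / K' on the arc of that circle hyperbolically close to z.
   The Taylor coefficients of the H_N are bounded by 2 H_N(0), so they converge
   along an ultrafilter, and K times the limit is the harmonic majorant. *)

Require Import Defs.
From HB Require Import structures.
From mathcomp Require Import all_boot all_order all_algebra.
From mathcomp Require Import cyclic separable cyclotomic complex ring lra.
From mathcomp Require Import all_classical all_reals all_analysis.

Set Implicit Arguments.
Unset Strict Implicit.
Unset Printing Implicit Defensive.

Import Order.TTheory GRing.Theory Num.Theory.
Import numFieldNormedType.Exports.

Local Open Scope classical_set_scope.
Local Open Scope complex_scope.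
Local Open Scope ring_scope.

Local Notation Re := complex.Re.
Local Notation Im := complex.Im.
Local Notation normc := Normc.normc.

(** * The real-valued modulus on the complex plane *)

Section Modulus.
Variable R : realType.
Implicit Types z w : R[i].

Lemma normc_sqr z : normc z ^+ 2 = Re z ^+ 2 + Im z ^+ 2.
Proof. by case: z => a b /=; rewrite sqr_sqrtr// addr_ge0 ?sqr_ge0. Qed.

Lemma normc_ge0 z : 0 <= normc z.
Proof. by case: z => a b; exact: sqrtr_ge0. Qed.

Lemma normrC z : `|z| = (normc z)%:C.
Proof. by case: z. Qed.

Lemma normc_real (x : R) : normc x%:C = `|x|.
Proof. by rewrite /= expr0n /= addr0 sqrtr_sqr. Qed.

Lemma normcX z n : normc (z ^+ n) = normc z ^+ n.
Proof.
by elim: n => [|n IH]; rewrite ?Normc.normc1// !exprS Normc.normcM IH.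
Qed.

Lemma normc_conj z : normc z^* = normc z.
Proof. by case: z => a b /=; rewrite sqrrN. Qed.

Lemma normc_sub z w : normc (z - w) = normc (w - z).
Proof. by rewrite -opprB normcN. Qed.

Lemma normc_le_sqr z (a : R) : 0 <= a ->
  (normc z <= a) = (Re z ^+ 2 + Im z ^+ 2 <= a ^+ 2).
Proof. by move=> a0; rewrite -normc_sqr ler_sqr ?nnegrE ?normc_ge0. Qed.

Lemma normc_Re z : `|Re z| <= normc z.
Proof.
by rewrite -ler_sqr ?nnegrE ?normc_ge0// normc_sqr real_normK ?num_real// lerDl sqr_ge0.
Qed.

Lemma normc_Im z : `|Im z| <= normc z.
Proof.
by rewrite -ler_sqr ?nnegrE ?normc_ge0// normc_sqr real_normK ?num_real// lerDr sqr_ge0.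
Qed.

Lemma normc_le_ReIm z : normc z <= `|Re z| + `|Im z|.
Proof.
rewrite normc_le_sqr ?addr_ge0// sqrrD !real_normK ?num_real//.
by rewrite -addrA [X in _ <= _ + X]addrC addrA lerDl mulrn_wge0// mulr_ge0.
Qed.

Lemma normc_sum (I : Type) (r : seq I) (P : pred I) (f : I -> R[i]) :
  normc (\sum_(i <- r | P i) f i) <= \sum_(i <- r | P i) normc (f i).
Proof.
elim/big_ind2: _ => [|x a y b xa yb|//]; first by rewrite Normc.normc0.
by rewrite (le_trans (le_normcD _ _))// lerD.
Qed.

Lemma ReD z w : Re (z + w) = Re z + Re w. Proof. by case: z; case: w. Qed.
Lemma ReN z : Re (- z) = - Re z. Proof. by case: z. Qed.
Lemma ReB z w : Re (z - w) = Re z - Re w. Proof. by rewrite ReD ReN. Qed.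
Lemma ImD z w : Im (z + w) = Im z + Im w. Proof. by case: z; case: w. Qed.
Lemma ImN z : Im (- z) = - Im z. Proof. by case: z. Qed.
Lemma ImB z w : Im (z - w) = Im z - Im w. Proof. by rewrite ImD ImN. Qed.
Lemma ReM z w : Re (z * w) = Re z * Re w - Im z * Im w.
Proof. by case: z; case: w. Qed.
Lemma ImM z w : Im (z * w) = Re z * Im w + Im z * Re w.
Proof. by case: z => a b; case: w => c d /=; rewrite addrC; congr +%R; rewrite mulrC. Qed.
Lemma ReZ (a : R) z : Re (a%:C * z) = a * Re z.
Proof. by rewrite ReM /= mul0r subr0. Qed.
Lemma Re_sum (I : Type) (r : seq I) (P : pred I) (f : I -> R[i]) :
  Re (\sum_(i <- r | P i) f i) = \sum_(i <- r | P i) Re (f i).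
Proof. by apply: big_morph => // x y; rewrite ReD. Qed.
Lemma mul_conj z : z * z^* = (normc z ^+ 2)%:C.
Proof.
rewrite normc_sqr; case: z => a b; apply/eqP; rewrite eq_complex /=.
by rewrite mulrN opprK -!expr2 eqxx mulrN mulrC addrC subrr eqxx.
Qed.

End Modulus.

(** * Positive harmonic polynomials *)

Section RootsOfUnity.
Variable R : realType.

(** ['X^J - 1] is separable and splits, so it has J distinct roots and hence a primitive one; the
    points are its powers. The second clause turns powers of conjugates back into powers, so that
    the power sums apply to them too. *)
Lemma roots_of_unity (J : nat) : (0 < J)%N ->
  exists ws : 'I_J -> R[i],
    [/\ forall j, normc (ws j) = 1, forall j, ws j ^+ J.-1 = (ws j)^*
    & forall n, \sum_(j < J) ws j ^+ n = if (J %| n)%N then J%:R else 0].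
Proof.
move=> J0.
have [w prw] : {w : R[i] | J.-primitive_root w}.
  have [rs rsE] := closed_field_poly_normal ('X^J - 1 : {poly R[i]}).
  have p_n0 : 'X^J - 1 != 0 :> {poly R[i]}.
    by rewrite -size_poly_eq0 size_XnsubC.
  have E : 'X^J - 1 = \prod_(z <- rs) ('X - z%:P) :> {poly R[i]}.
    have lc : lead_coef ('X^J - 1 : {poly R[i]}) = 1.
      by apply/eqP; rewrite -monicE monicXnsubC.
    by rewrite {1}rsE lc scale1r.
  have U : uniq rs.
    rewrite -separable_prod_XsubC -E separable_Xn_sub_1//.
    by rewrite pnatr_eq0 -lt0n.
  have srs : size rs = J.
    have := size_prod_XsubC rs id; rewrite -E size_XnsubC// => -[].
    by move=> ->.
  have H : has J.-primitive_root rs.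
    apply: has_prim_root => //; last by rewrite srs.
    apply/allP => z zrs; rewrite unity_rootE -subr_eq0.
    have : root ('X^J - 1) z by rewrite E root_prod_XsubC.
    by rewrite rootE !hornerE.
  by exists (nth 0 rs (find J.-primitive_root rs)); exact: nth_find.
have wJ := prim_expr_order prw.
have nw : normc w = 1.
  have : normc w ^+ J = 1 by rewrite -normcX wJ Normc.normc1.
  by move=> /eqP; rewrite pexpr_eq1 ?normc_ge0// => /eqP.
have nwj j : normc (w ^+ j) = 1 by rewrite normcX nw expr1n.
exists (fun j => w ^+ j); split=> // [j|n].
  have w0 : w ^+ j != 0.
    by apply/eqP => w0; move/eqP: (nwj j); rewrite w0 Normc.normc0 eq_sym oner_eq0.
  apply: (mulfI w0); rewrite mul_conj nwj expr1n.
  by rewrite -exprS prednK// -exprM mulnC exprM wJ expr1n.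
under eq_bigr do rewrite -exprM mulnC exprM.
case: ifPn => [dvd|ndvd].
  under eq_bigr do rewrite (eqP (_ : w ^+ n == 1)) -?(prim_order_dvd prw)// expr1n.
  by rewrite sumr_const card_ord.
have wn1 : w ^+ n - 1 != 0 by rewrite subr_eq0 -(prim_order_dvd prw).
apply: (mulfI wn1); rewrite mulr0 -subrX1 -exprM mulnC exprM.
by rewrite wJ expr1n subrr.
Qed.

(** Discrete Fourier orthogonality: after exchanging the sums only the exponents divisible by J
    survive. *)
Lemma sum_horner_roots (J : nat) (ws : 'I_J -> R[i])
    (wsX : forall n, \sum_(j < J) ws j ^+ n = if (J %| n)%N then J%:R else 0)
    (q : {poly R[i]}) m :
  \sum_(j < J) q.[ws j] * ws j ^+ m =
  J%:R * \sum_(i < size q | (J %| i + m)%N) q`_i.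
Proof.
under eq_bigr do rewrite horner_coef mulr_suml.
rewrite exchange_big/= mulr_sumr [RHS]big_mkcond/=; apply: eq_bigr => i _.
under eq_bigr do rewrite -mulrA -exprD.
rewrite -mulr_sumr wsX; case: ifP => _; last by rewrite mulr0.
by rewrite mulrC.
Qed.

Lemma sum_horner_roots0 (J : nat) (ws : 'I_J -> R[i])
    (wsX : forall n, \sum_(j < J) ws j ^+ n = if (J %| n)%N then J%:R else 0)
    (q : {poly R[i]}) : (size q <= J)%N ->
  \sum_(j < J) q.[ws j] = J%:R * q`_0.
Proof.
move=> sq.
have := sum_horner_roots wsX q 0.
under eq_bigr do rewrite expr0 mulr1.
move=> ->; rewrite big_mkcond/=; congr *%R.
have [q0|q0] := posnP (size q).
  by rewrite nth_default ?q0// big1// => i _; rewrite nth_default ?if_same// q0.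
rewrite (bigD1 (Ordinal q0))//= dvdn0 big1 ?addr0// => i i0; rewrite addn0.
case: ifP => // /dvdn_leq; rewrite lt0n.
have -> : (val i != 0)%N by move: i0; rewrite -val_eqE.
by move=> /(_ isT); rewrite leqNgt (leq_trans (ltn_ord i) sq).
Qed.

End RootsOfUnity.

(** * Harnack's inequality for real parts of polynomials *)

Section Harnack.
Variable R : realType.

(* Averaging 2 Re q(w) w^-k over roots of unity of large order gives q`_k. *)
Lemma coef_bound (q : {poly R[i]}) :
  (forall w, normc w = 1 -> 0 <= Re q.[w]) ->
  forall k, (0 < k)%N -> normc q`_k <= 2 * Re q`_0.
Proof.
move=> q0 k k0; pose J := (size q + k)%N.
have J0 : (0 < J)%N by rewrite addn_gt0 k0 orbT.
have [ws [ws1 wsC wsX]] := roots_of_unity R J0.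
have [kq|kq] := leqP (size q) k.
  rewrite nth_default// Normc.normc0 mulr_ge0//.
  have := sum_horner_roots0 wsX (leq_addr k _).
  move=> /(congr1 (fun z => Re z)); rewrite Re_sum.
  have -> : J%:R = (J%:R : R)%:C by rewrite rmorph_nat.
  rewrite ReZ => E.
  by rewrite -(@pmulr_rge0 _ J%:R) ?ltr0n// -E sumr_ge0// => j _; exact: q0.
have S1 : \sum_(j < J) q.[ws j] * (ws j)^* ^+ k = J%:R * q`_k.
  under eq_bigr do rewrite -wsC -exprM.
  rewrite (sum_horner_roots wsX) (bigD1 (Ordinal kq))/=; last first.
    by rewrite -mulSn prednK// dvdn_mulr.
  rewrite big1 ?addr0// => i /andP[Ji]; rewrite -val_eqE/= => ik.
  have kJ : (k < J)%N by rewrite -[ltnLHS]add0n ltn_add2r (leq_ltn_trans _ kq).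
  have iJ : (i < J)%N by rewrite (leq_trans (ltn_ord i))// leq_addr.
  have : i = k %[mod J].
    have E : (i + J.-1 * k + k = k * J + i)%N.
      by rewrite -[in RHS](prednK J0) mulnS (mulnC k) [RHS]addnC -addnA [(_ + k)%N]addnC.
    by rewrite -(modnMDl k i J) -E -modnDml (eqP Ji) add0n.
  by rewrite !modn_small// => /eqP; rewrite (negbTE ik).
(* The conjugate part contributes nothing: the exponents i + k with i < [size q] lie strictly
   between 0 and J. *)
have S2 : \sum_(j < J) (q.[ws j])^* * (ws j)^* ^+ k = 0.
  transitivity ((\sum_(j < J) q.[ws j] * ws j ^+ k)^*).
    by rewrite rmorph_sum; apply: eq_bigr => j _; rewrite rmorphM rmorphXn.
  apply/eqP; rewrite conjc_eq0 (sum_horner_roots wsX).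
  rewrite big1 ?mulr0// => i Ji.
  have := dvdn_leq _ Ji; rewrite addn_gt0 k0 orbT => /(_ isT).
  by rewrite leqNgt /J ltn_add2r ltn_ord.
have S : \sum_(j < J) (2 * Re q.[ws j])%:C * (ws j)^* ^+ k = J%:R * q`_k.
  have := congr2 +%R S1 S2; rewrite addr0 -big_split/= => <-; apply: eq_bigr => j _.
  by rewrite -mulrDl addcJ rmorphM rmorph_nat.
have JC : J%:R = (J%:R : R)%:C by rewrite rmorph_nat.
have Jgt : 0 < J%:R :> R by rewrite ltr0n.
rewrite -(ler_pM2l Jgt) -[X in X * normc _]ger0_norm ?ler0n//.
rewrite -normc_real -JC -Normc.normcM -S.
rewrite mulrCA -ReZ -JC -(sum_horner_roots0 wsX) ?leq_addr// Re_sum mulr_sumr.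
apply: le_trans (normc_sum _ _ _) _; apply: ler_sum => j _.
rewrite Normc.normcM normcX normc_conj ws1 expr1n mulr1 normc_real ger0_norm//.
by rewrite mulr_ge0// q0.
Qed.

(** By [coef_bound] the series at |z| <= 1/2 is dominated by Re q(0) (1 + 2 (1/2 + 1/4 + ...)),
    whose value is 3 Re q(0). *)
Lemma disk_growth (q : {poly R[i]}) :
  (forall w, normc w = 1 -> 0 <= Re q.[w]) ->
  forall z, normc z <= 1/2 -> Re q.[z] <= 3 * Re q`_0.
Proof.
move=> q0 z z12.
have c0 : 0 <= Re q`_0.
  have := coef_bound q0 (isT : 0 < 1)%N; rewrite -[0 <= _](pmulr_rge0 _ (ltr0n R 2)).
  by apply: le_trans; exact: normc_ge0.
have -> : q.[z] = \sum_(i < (size q).+1) q`_i * z ^+ i.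
  rewrite (horner_coef_wide z (leqnSn _)).
  by [].
rewrite Re_sum big_ord_recl/= expr0 mulr1.
have H (i : nat) : Re (q`_i.+1 * z ^+ i.+1) <= 2 * Re q`_0 * (1/2) ^+ i.+1.
  apply: le_trans (ler_norm _) _; apply: le_trans (normc_Re _) _.
  rewrite Normc.normcM normcX ler_pM ?exprn_ge0 ?normc_ge0// ?coef_bound//.
  by rewrite lerXn2r ?nnegrE ?normc_ge0.
apply: (@le_trans _ _ (Re q`_0 + \sum_(i < size q) 2 * Re q`_0 * (1/2) ^+ i.+1)).
  by rewrite lerD2l ler_sum// => i _; exact: H.
rewrite -mulr_sumr.
suff E n : \sum_(i < n) (1 / 2) ^+ i.+1 = 1 - (1 / 2) ^+ n :> R.
  have : 0 <= (1 / 2) ^+ size q :> R by rewrite exprn_ge0.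
  by rewrite E; nra.
elim: n => [|n IH]; first by rewrite big_ord0 expr0 subrr.
by rewrite big_ord_recr/= IH exprS; field.
Qed.

(** An affine change of variable reduces this to [disk_growth]; for rho = 0 that change is not
    invertible, but then z = a. *)
Lemma harnack (p : {poly R[i]}) (a : R[i]) (rho : R) : 0 <= rho ->
  (forall w, normc (w - a) <= rho -> 0 <= Re p.[w]) ->
  forall z, normc (z - a) <= rho / 2 -> Re p.[z] <= 3 * Re p.[a].
Proof.
rewrite le_eqVlt => /predU1P[<- p0 z|rho0 p0 z].
  rewrite mul0r => za; have := p0 z za.
  have : normc (z - a) = 0 by apply/eqP; rewrite eq_le za normc_ge0.
  by move=> /Normc.eq0_normc/eqP; rewrite subr_eq0 => /eqP ->; lra.
move=> za; pose q := p \Po (rho%:C *: 'X + a%:P).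
have rhoC : rho%:C != 0 by rewrite (_ : 0 = 0%:C)// (inj_eq (@complexI _)) gt_eqF.
have qE w : q.[w] = p.[rho%:C * w + a] by rewrite horner_comp !hornerE.
have -> : z = rho%:C * ((z - a) / rho%:C) + a by rewrite mulrC divfK// subrK.
have -> : p.[a] = q`_0 by rewrite -horner_coef0 qE mulr0 add0r.
rewrite -qE; apply: disk_growth => [w w1|].
  by rewrite qE p0// addrK Normc.normcM w1 mulr1 normc_real gtr0_norm.
rewrite Normc.normcM Normc.normcV normc_real gtr0_norm// ler_pdivrMr//.
by rewrite mulrC mul1r.
Qed.

End Harnack.

(** * Fejer approximation on the circle *)

Section Fejer.
Variable R : realType.
Implicit Types z w : R[i].

Lemma normc_sqrD z w :
  normc (z + w) ^+ 2 = normc z ^+ 2 + 2 * Re (w * z^*) + normc w ^+ 2.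
Proof. by case: z => a b; case: w => c d; rewrite !normc_sqr /=; ring. Qed.

(** On the unit circle the summand of index l has the Dirichlet kernel of order l as its real part,
    so Re [fejer m] is m times the Fejer kernel, here completed to an analytic polynomial. *)
Definition fejer m : {poly R[i]} :=
  \sum_(l < m) (1 + 2 *: \sum_(k < l) 'X^(k.+1)).

Lemma horner_fejer m z :
  (fejer m).[z] = \sum_(l < m) (1 + 2 * \sum_(k < l) z ^+ k.+1).
Proof.
rewrite /fejer horner_sum; apply: eq_bigr => l _.
by rewrite !hornerE horner_sum; under [in LHS]eq_bigr do rewrite hornerXn.
Qed.

Lemma size_fejer m : (size (fejer m) <= m)%N.
Proof.
apply: (leq_trans (size_sum _ _ _)); apply/bigmax_leqP => l _.
apply: (leq_trans (size_polyD _ _)); rewrite size_poly1 geq_max.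
rewrite (leq_ltn_trans (leq0n _) (ltn_ord l))/=.
apply: (leq_trans (size_scale_leq _ _)).
apply: (leq_trans (size_sum _ _ _)); apply/bigmax_leqP => k _.
by rewrite size_polyXn (leq_ltn_trans (ltn_ord k)).
Qed.

Lemma fejer0 m : (fejer m)`_0 = m%:R.
Proof.
rewrite -horner_coef0 horner_fejer -[in RHS](card_ord m) -sumr_const.
apply: eq_bigr => l _; rewrite big1 ?mulr0 ?addr0// => k _.
by rewrite expr0n.
Qed.

(* In particular Re fejer is nonnegative on the circle, and multiplying it by
   |1 - w|^2 gives |1 - w^m|^2. *)
Lemma fejer_kernel m w : normc w = 1 ->
  Re (fejer m).[w] = normc (\sum_(a < m) w ^+ a) ^+ 2.
Proof.
move=> w1; rewrite horner_fejer.
elim: m => [|m IH]; first by rewrite !big_ord0 Normc.normc0 expr0n.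
rewrite !big_ord_recr/= ReD {}IH normc_sqrD normcX w1 !expr1n -addrA; congr +%R.
rewrite ReD addrC; congr +%R.
have -> : (2 : R[i]) = 2%:C by rewrite rmorph_nat.
rewrite ReZ; congr (_ * Re _).
rewrite rmorph_sum mulr_sumr (reindex_inj rev_ord_inj)/=; apply: eq_bigr => a _.
have -> : w ^+ m = w ^+ (m - a) * w ^+ a by rewrite -exprD subnK// ltnW.
by rewrite -mulrA mul_conj normcX w1 !expr1n mulr1 -subSn// subSS.
Qed.

(* The Fejer means of f sampled at the J-th roots of unity: the kernel is a
   probability on these J = m + 1 points whose second moment about z is 2 / m. *)
Lemma fejer_approx (f : R[i] -> R) (L eps : R) : 0 <= L -> 0 < eps ->
  (forall z w, normc z = 1 -> normc w = 1 -> `|f z - f w| <= L * normc (z - w)) ->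
  exists p : {poly R[i]}, forall z, normc z = 1 -> `|Re p.[z] - f z| <= eps.
Proof.
move=> L0 eps0 fL.
(* With t = |z - node|, the error L t is split by t <= eta + t^2 / eta. This [eta] makes the first
   part at most eps / 2, and [m] makes the second moment part 2 L / (eta m) at most eps / 2. *)
pose eta := eps / (2 * (L + 1)).
have eta0 : 0 < eta by rewrite divr_gt0// mulr_gt0// ltr_wpDl.
pose m := (Num.truncn (4 * L / (eta * eps))).+1.
have mP : 4 * L / (eta * eps) < m%:R by exact: truncnS_gt.
have m0 : 0 < m%:R :> R by rewrite ltr0n.
pose J := m.+1.
have J0 : 0 < J%:R :> R by rewrite ltr0n.
have [ws [ws1 _ wsX]] := @roots_of_unity R J isT.
pose N : R := J%:R * m%:R.
have N0 : 0 < N by rewrite mulr_gt0.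
(* The nodes are the conjugates of the [ws j], so that the kernel is evaluated at [ws j * z], which
   is polynomial in z. *)
pose p := \sum_(j < J) (f (ws j)^* / N)%:C *: (fejer m \Po (ws j *: 'X)).
exists p => z z1.
pose K j := Re (fejer m).[ws j * z].
have wz1 j : normc (ws j * z) = 1 by rewrite Normc.normcM ws1 z1 mulr1.
have K0 j : 0 <= K j by rewrite /K fejer_kernel// sqr_ge0.
have JC : J%:R = (J%:R : R)%:C by rewrite rmorph_nat.
have sumK : \sum_j K j = N.
  have := @sum_horner_roots0 _ _ _ wsX (fejer m \Po (z *: 'X)).
  have -> : (fejer m \Po (z *: 'X))`_0 = m%:R.
    by rewrite -horner_coef0 horner_comp !hornerE ?mulr0 ?horner_coef0 fejer0.
  move=> /(_ _)/(congr1 (fun x => Re x)); rewrite Re_sum => E.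
  rewrite /N -[RHS]/(Re (J%:R * m%:R)%:C) rmorphM !rmorph_nat -E.
    by apply: eq_bigr => j _; rewrite /K horner_comp !hornerE mulrC.
  apply: (leq_trans (size_comp_poly_leq _ _)); rewrite ltnS.
  have sX : ((size (z *: 'X)).-1 <= 1)%N.
    by have := size_scale_leq z 'X; rewrite size_polyX; case: size => [|[|]].
  by rewrite -[leqRHS]muln1 leq_mul// (leq_trans (leq_pred _))// size_fejer.
(* For w = [ws j * z], the kernel formula gives |1 - w|^2 K = |1 - w^m|^2 = 2 - 2 Re w^m, and the
   sum of the w^m vanishes because 0 < m < J. *)
have sumK2 : \sum_j normc (z - (ws j)^*) ^+ 2 * K j = 2 * J%:R.
  have E j : normc (z - (ws j)^*) ^+ 2 * K j = 2 - 2 * Re (z ^+ m *: 'X^m).[ws j].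
    have -> : normc (z - (ws j)^*) = normc (1 - ws j * z).
      rewrite -[LHS]mul1r -(ws1 j) -Normc.normcM mulrBr mul_conj ws1 expr1n.
      by rewrite normc_sub.
    rewrite /K fejer_kernel// -exprMn -Normc.normcM -opprB mulNr -subrX1 opprB.
    rewrite normc_sqrD !Normc.normc1 normcN normcX wz1 !expr1n rmorph1 mulr1 ReN.
    have -> : (z ^+ m *: 'X^m).[ws j] = (ws j * z) ^+ m.
      by rewrite !hornerE exprMn mulrC.
    by lra.
  under eq_bigr do rewrite E.
  rewrite sumrB sumr_const card_ord -mulr_sumr -Re_sum.
  rewrite (sum_horner_roots0 wsX); last first.
    by rewrite (leq_trans (size_scale_leq _ _))// size_polyXn.
  by rewrite coefZ coefXn /= !mulr0 subr0 mulr_natr.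
have -> : Re p.[z] - f z = \sum_j (f (ws j)^* - f z) * (K j / N).
  have sum1 : \sum_j f z * (K j / N) = f z.
    by rewrite -mulr_sumr -mulr_suml sumK divff ?gt_eqF ?mulr1.
  rewrite -{1}sum1 /p horner_sum Re_sum -sumrB; apply: eq_bigr => j _.
  by rewrite hornerZ horner_comp hornerZ hornerX ReZ -/(K j) mulrBl mulrAC -mulrA.
apply: le_trans (ler_norm_sum _ _ _) _.
have step j : `|(f (ws j)^* - f z) * (K j / N)| <=
   L * eta / N * K j + L / (eta * N) * (normc (z - (ws j)^*) ^+ 2 * K j).
  have KN0 : 0 <= K j / N by rewrite divr_ge0// ltW.
  rewrite normrM [X in _ * X]ger0_norm//.
  have := fL (ws j)^* z; rewrite normc_conj => /(_ (ws1 j) z1) H.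
  apply: (@le_trans _ _ (L * normc ((ws j)^* - z) * (K j / N))).
    by rewrite ler_wpM2r.
  rewrite normc_sub; set t := normc _.
  have tE : t <= eta + t ^+ 2 / eta.
    rewrite -(ler_pM2r eta0) mulrDl divfK ?gt_eqF//.
    by have := sqr_ge0 (t - eta); have := normc_ge0 (z - (ws j)^*); rewrite -/t; nra.
  apply: (@le_trans _ _ (L * (eta + t ^+ 2 / eta) * (K j / N))).
    by rewrite ler_wpM2r// ler_wpM2l.
  by rewrite le_eqVlt; apply/orP; left; apply/eqP; field; rewrite !gt_eqF.
apply: (le_trans (ler_sum _ (fun j _ => step j))).
rewrite big_split/= -!mulr_sumr sumK sumK2.
have -> : L * eta / N * N + L / (eta * N) * (2 * J%:R) = L * eta + 2 * L / (eta * m%:R).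
  by rewrite /N; field; rewrite !gt_eqF.
have h1 : L * eta <= eps / 2.
  rewrite /eta mulrA ler_pdivrMr ?mulr_gt0 ?ltr_wpDl//.
  by nra.
have h2 : 2 * L / (eta * m%:R) <= eps / 2.
  have em0 : 0 < eta * m%:R by exact: mulr_gt0.
  have ee0 : 0 < eta * eps by exact: mulr_gt0.
  rewrite ler_pdivrMr//.
  by move/ltW: mP; rewrite ler_pdivrMr// => mP; nra.
by lra.
Qed.

End Fejer.

(** * Circle means and the minimum principle *)

Section CircleMeans.
Variable R : realType.
Implicit Types z w : R[i].
Local Notation mu := (@lebesgue_measure R).

Definition cis (t : R) : R[i] := cos t +i* sin t.

Lemma normc_cis t : normc (cis t) = 1.
Proof. by rewrite /= cos2Dsin2 sqrtr1. Qed.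

Lemma cisX t n : cis t ^+ n = cis (n%:R * t).
Proof.
elim: n => [|n IH]; first by rewrite mul0r /cis cos0 sin0.
rewrite exprS IH -[in RHS]natr1 mulrDl mul1r addrC /cis cosD sinD.
apply/eqP; rewrite eq_complex /=; apply/andP; split; apply/eqP; ring.
Qed.

Lemma cis0 : cis 0 = 1. Proof. by rewrite /cis cos0 sin0. Qed.

Lemma cis2pi n : cis (n%:R * (2 * pi)) = 1.
Proof.
by rewrite -cisX /cis -[2 * pi]add0r mulr_natl cosD2pi sinD2pi cos0 sin0 expr1n.
Qed.

(** Real and imaginary parts go through the induction together, since multiplication mixes them. *)
Lemma continuous_horner (T : topologicalType) (g : T -> R[i]) (x : T)
    (p : {poly R[i]}) :
  {for x, continuous (fun t => Re (g t))} ->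
  {for x, continuous (fun t => Im (g t))} ->
  {for x, continuous (fun t => Re p.[g t])} /\
  {for x, continuous (fun t => Im p.[g t])}.
Proof.
move=> cr ci; elim/poly_ind: p => [|p c [IHr IHi]].
  split.
    rewrite (_ : (fun t => _) = fun=> 0); first exact: cst_continuous.
    by apply/funext => t; rewrite horner0.
  rewrite (_ : (fun t => _) = fun=> 0); first exact: cst_continuous.
  by apply/funext => t; rewrite horner0.
split.
- rewrite (_ : (fun t => _) = fun t =>
    Re p.[g t] * Re (g t) - Im p.[g t] * Im (g t) + Re c); last first.
    by apply/funext => t; rewrite !hornerE ReD ReM.
  apply: continuousD; last exact: cst_continuous.
  by apply: continuousB; exact: continuousM.
- rewrite (_ : (fun t => _) = fun t =>
    Re p.[g t] * Im (g t) + Im p.[g t] * Re (g t) + Im c); last first.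
    by apply/funext => t; rewrite !hornerE ImD ImM.
  apply: continuousD; last exact: cst_continuous.
  by apply: continuousD; exact: continuousM.
Qed.

(* Pointwise continuity for the real-valued modulus, which makes no reference to
   the topologies of R[i], R * R and of the parameter of a circle. *)
Definition mcontinuous (f : R[i] -> R) z := forall eps : R, 0 < eps ->
  exists2 d : R, 0 < d & forall w, normc (w - z) < d -> `|f w - f z| < eps.

Lemma continuous_mcomp (T : topologicalType) (g : T -> R[i]) (x : T)
    (f : R[i] -> R) :
  {for x, continuous (fun t => Re (g t))} ->
  {for x, continuous (fun t => Im (g t))} ->
  mcontinuous f (g x) -> {for x, continuous (f \o g)}.
Proof.
move=> cr ci cf; apply/cvgrPdist_lt => eps /cf[d d0 fd].
have d20 : 0 < d / 2 by rewrite divr_gt0.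
move/cvgrPdist_lt: cr => /(_ _ d20) cr; move/cvgrPdist_lt: ci => /(_ _ d20) ci.
near=> t; rewrite /= distrC; apply: fd.
apply: le_lt_trans (normc_le_ReIm _) _; rewrite ReB ImB.
rewrite -(subrKC (d / 2) d) distrC [X in _ + X < _]distrC.
have -> : d - d / 2 = d / 2 by field.
by apply: ltrD; near: t.
Unshelve. all: by end_near. Qed.

Lemma continuous_cis t :
  {for t, continuous (fun t => Re (cis t))} /\ {for t, continuous (fun t => Im (cis t))}.
Proof. by split; [exact: continuous_cos|exact: continuous_sin]. Qed.

Let pi2 : 0 < 2 * pi :> R. Proof. by rewrite mulr_gt0 ?pi_gt0. Qed.

Lemma derive_cis_coef (a : R[i]) (n : nat) (t : R) :
  is_derive t 1 (fun t : R => if n is 0 then Re a * t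
    else n%:R^-1 * (Re a * sin (n%:R * t) + Im a * cos (n%:R * t)))
    (Re (a * cis t ^+ n)).
Proof.
rewrite cisX; case: n => [|n].
  apply: is_derive_eq; rewrite mul0r cis0 mulr1 /GRing.scale /=; ring.
apply: is_derive_eq; rewrite /GRing.scale /= ReM /=.
by field; rewrite nat1r pnatr_eq0.
Qed.

(** The mean value property: the terms of positive degree have antiderivatives of period 2 pi, so
    only the constant term contributes. *)
Lemma integral_horner_cis (q : {poly R[i]}) :
  (\int[mu]_(t in `[0%R, (2 * pi)%R]) (Re q.[cis t])%:E = (2 * pi * Re q`_0)%:E)%E.
Proof.
pose F n (t : R) := if n is 0 then Re q`_n * t
  else n%:R^-1 * (Re q`_n * sin (n%:R * t) + Im q`_n * cos (n%:R * t)).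
pose G := \sum_(n < (size q).+1) F n.
have dG (t : R) : is_derive t (1 : R) (G : R -> R) (Re q.[cis t]).
  rewrite (horner_coef_wide _ (leqnSn _)) Re_sum.
  by apply: is_derive_sum => i; exact: (derive_cis_coef q`_i i t).
rewrite (@continuous_FTC2 _ _ G)//.
- rewrite /G !fct_sumE -EFinB -sumrB big_ord_recl big1 /= ?addr0.
    by rewrite mulr0 subr0 mulrC.
  move=> i _; rewrite !mulr0 cos0 sin0.
  by have := cis2pi (bump 0 i); rewrite /cis => -[-> ->]; rewrite subrr.
- apply: continuous_subspaceT => t.
  have [cr ci] := continuous_cis t.
  by have [] := continuous_horner q cr ci.
- split.
  + by move=> t _; have [] := dG t.
  + apply: cvg_at_right_filter; apply: differentiable_continuous.
    by apply/derivable1_diffP; have [] := dG 0.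
  + apply: cvg_at_left_filter; apply: differentiable_continuous.
    by apply/derivable1_diffP; have [] := dG (2 * pi).
- by move=> t _; rewrite derive1E; have [_ ->] := dG t.
Qed.

Lemma normc_sqr_circle z (s t : R) :
  normc (circle_pt z s t) ^+ 2 = normc z ^+ 2 + s ^+ 2 + 2 * s * Re (cis t * z^*).
Proof.
rewrite /circle_pt -/(cis t) normc_sqrD -mulrA ReZ Normc.normcM normc_cis mulr1.
by rewrite normc_real real_normK ?num_real//; ring.
Qed.

Lemma circle_mean0 z s : circle_mean (fun=> 0%:E) z s = 0%E :> \bar R.
Proof. by rewrite /circle_mean integral0 mule0. Qed.

Lemma continuous_circle z (s t : R) :
  {for t, continuous (fun t => Re (circle_pt z s t))} /\
  {for t, continuous (fun t => Im (circle_pt z s t))}.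
Proof.
have [cr ci] := continuous_cis t.
have E x : circle_pt z s x = (s%:C *: 'X + z%:P).[cis x] by rewrite !hornerE addrC.
have Er : (fun t => Re (circle_pt z s t)) = fun t => Re (s%:C *: 'X + z%:P).[cis t].
  by apply/funext => x; rewrite E.
have Ei : (fun t => Im (circle_pt z s t)) = fun t => Im (s%:C *: 'X + z%:P).[cis t].
  by apply/funext => x; rewrite E.
by rewrite Er Ei; exact: continuous_horner.
Qed.

(* Subtracting eps |w|^2 makes the super-mean-value inequality strict. *)
Lemma no_interior_min (u : R[i] -> R) (p : {poly R[i]}) (eps s : R) z :
  0 < eps -> 0 < s ->
  (forall t, mcontinuous u (circle_pt z s t)) ->
  (circle_mean (EFin \o u) z s <= (u z)%:E)%E ->
  exists t, let w := circle_pt z s t in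
    u w - Re p.[w] - eps * normc w ^+ 2 < u z - Re p.[z] - eps * normc z ^+ 2.
Proof.
move=> eps0 s0 cu um; apply: contrapT => /forallNP H.
(* On the circle |w|^2 is affine in Re (cis t conj z), so Re p(w) + eps |w|^2 is itself the real
   part of a polynomial in cis t. If the claim fails then Re Q <= u on the circle, while the mean of
   Re Q is u(z) + eps s^2 > u(z). *)
pose Q := (p \Po (s%:C *: 'X + z%:P)) + (2 * eps * s)%:C *: (z^* *: 'X)
  + ((u z - Re p.[z] + eps * s ^+ 2)%:C)%:P.
have QE t : Re Q.[cis t] = Re p.[circle_pt z s t] + u z - Re p.[z] +
    eps * (normc (circle_pt z s t) ^+ 2 - normc z ^+ 2).
  rewrite /Q !(hornerD, hornerZ, hornerC, hornerX, horner_comp) !ReD !ReZ /=.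
  rewrite normc_sqr_circle [s%:C * _ + z]addrC -/(circle_pt z s t).
  by rewrite [z^* * _]mulrC /=; ring.
have Q0 : Re Q`_0 = u z + eps * s ^+ 2.
  rewrite -horner_coef0 /Q !(hornerD, hornerZ, hornerC, hornerX, horner_comp) !ReD.
  by rewrite !(mulr0, add0r) /=; ring.
have Qu t : Re Q.[cis t] <= u (circle_pt z s t).
  by rewrite QE; have /negP := H t; rewrite -leNgt /=; lra.
have cptI := @segment_compact R 0 (2 * pi).
have iQ : mu.-integrable `[0%R, (2 * pi)%R] (EFin \o (fun t => Re Q.[cis t])).
  apply: continuous_compact_integrable => //.
  apply: continuous_subspaceT => t; have [cr ci] := continuous_cis t.
  by have [] := continuous_horner Q cr ci.
have iu : mu.-integrable `[0%R, (2 * pi)%R] (EFin \o (u \o circle_pt z s)).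
  apply: continuous_compact_integrable => //.
  apply: continuous_subspaceT => t; have [cr ci] := continuous_circle z s t.
  by apply: continuous_mcomp.
have le1 : (\int[mu]_(t in `[0%R, (2 * pi)%R]) (Re Q.[cis t])%:E <=
    \int[mu]_(t in `[0%R, (2 * pi)%R]) (u (circle_pt z s t))%:E)%E.
  by apply: (le_integral _ iQ iu) => // t; rewrite lee_fin Qu.
move: le1; rewrite integral_horner_cis Q0 => le1; move: um; rewrite /circle_mean => um.
have pi2V : (0 <= (2 * pi)^-1 :> R)%R by rewrite invr_ge0 ltW.
have := le_trans (lee_wpmul2l (_ : (0 <= ((2 * pi)^-1)%:E)%E) le1) um.
rewrite lee_fin => /(_ pi2V); rewrite -EFinM lee_fin mulrA mulVf ?gt_eqF// mul1r.
by have := mulr_gt0 eps0 (exprn_gt0 2 s0); lra.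
Qed.

(** On the compact K, u - Re p - eps |w|^2 attains its minimum, and by [no_interior_min] not at a
    point that has a super-mean circle. So Re p <= u at the minimum point, and |w| <= 1 on K bounds
    the loss elsewhere by eps, which then tends to 0. The alternative at each point lets K be a disk
    or a disk cut by a chord. *)
Lemma min_principle (u : R[i] -> R) (p : {poly R[i]}) (K : set R[i]) :
  (forall z, K z -> normc z <= 1) ->
  closed [set x : R * R | K (x.1 +i* x.2)] ->
  (forall z, K z -> mcontinuous u z) ->
  (forall z, K z -> Re p.[z] <= u z \/
    exists s : R, [/\ 0 < s, forall w, normc (w - z) <= s -> K w
      & (circle_mean (EFin \o u) z s <= (u z)%:E)%E]) ->
  forall z, K z -> Re p.[z] <= u z.
Proof.
move=> K1 clK cu uK z0 Kz0.
pose K' : set (R * R) := [set x : R * R | K (x.1 +i* x.2)].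
have cptK : compact K'.
  apply: (@subclosed_compact _ _ (`[(-1 : R), 1] `*` `[(-1 : R), 1])%classic) => //.
    by apply: compact_setX; exact: segment_compact.
  move=> [x y] /K1 /= n1; have := normc_Re (x +i* y); have := normc_Im (x +i* y).
  move=> /le_trans/(_ n1)/=; rewrite ler_norml => /andP[a b].
  move=> /le_trans/(_ n1)/=; rewrite ler_norml => /andP[c d].
  by split; rewrite /= in_itv/= ?a ?b ?c ?d.
have eps_bound (eps : R) : 0 < eps -> Re p.[z0] <= u z0 + eps.
  move=> eps0.
  pose F (x : R * R) := let w := x.1 +i* x.2 in u w - Re p.[w] - eps * normc w ^+ 2.
  have cF : {within K', continuous F}.
    apply: continuous_in_subspaceT => x; rewrite inE => Kx.
    have cr : {for x, continuous (fun x : R * R => Re (x.1 +i* x.2))} by exact: cvg_fst.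
    have ci : {for x, continuous (fun x : R * R => Im (x.1 +i* x.2))} by exact: cvg_snd.
    have c1 := @continuous_mcomp _ (fun x : R * R => x.1 +i* x.2) x u cr ci (cu _ Kx).
    have [c2 _] := @continuous_horner _ (fun x : R * R => x.1 +i* x.2) x p cr ci.
    have c3 : {for x, continuous (fun y : R * R => eps * (y.1 * y.1 + y.2 * y.2))}.
      apply: continuousM; first exact: cst_continuous.
      by apply: continuousD; apply: continuousM.
    have := continuousB (continuousB c1 c2) c3.
    congr (continuous_at _ _); apply/funext => y.
    by rewrite /F !fctE normc_sqr /= !expr2.
  have K'0 : K' !=set0 by exists (Re z0, Im z0); rewrite /K' /=; case: (z0) Kz0.
  have [c] := compact_EVT_min K'0 cptK cF.
  rewrite inE => Kc minF.
  pose zc := c.1 +i* c.2.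
  have minz w : K w -> u zc - Re p.[zc] - eps * normc zc ^+ 2 <=
      u w - Re p.[w] - eps * normc w ^+ 2.
    move=> Kw; have := minF (Re w, Im w); rewrite inE /K' /F /=.
    by case: (w) Kw => a b Kw /(_ Kw).
  have H : Re p.[zc] <= u zc.
    have [//|[s [s0 sK um]]] := uK zc Kc.
    have sKt t : K (circle_pt zc s t).
      apply: sK; rewrite /circle_pt addrC addKr Normc.normcM normc_real.
      by rewrite gtr0_norm// (normc_cis t) mulr1.
    have [|t /=] := @no_interior_min u p eps s zc eps0 s0 _ um.
      by move=> t; apply: cu.
    by rewrite ltNge minz.
  have := minz _ Kz0.
  have := K1 _ Kc; have := normc_ge0 zc; have := normc_ge0 z0; rewrite -/zc.
  move=> a b c1.
  have : normc zc ^+ 2 <= 1 by rewrite exprn_ile1.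
  have : 0 <= normc z0 ^+ 2 by rewrite exprn_ge0.
  by nra.
by apply/ler_addgt0Pr => eps /eps_bound.
Qed.

End CircleMeans.

(** * Log-Lipschitz functions *)

Section HyperbolicDistance.
Variable R : realType.
Implicit Types z w : R[i].

Lemma unit_diskE z : unit_disk z <-> normc z < 1.
Proof. by rewrite /unit_disk /= normrC -[1 in X in _ <-> X]/1 -(ltcR _ 1). Qed.

(** This identity gives both 1 - d^2 and the nonvanishing of the denominator of d. *)
Lemma sqr_1subM_conj z w :
  normc (1 - z * w^*) ^+ 2 =
  normc (z - w) ^+ 2 + (1 - normc z ^+ 2) * (1 - normc w ^+ 2).
Proof. by case: z => a b; case: w => c d; rewrite !normc_sqr /=; ring. Qed.

Lemma normc_1subM_conj_le2 z w : normc z <= 1 -> normc w <= 1 ->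
  normc (1 - z * w^*) <= 2.
Proof.
move=> z1 w1; apply: le_trans (le_normcD _ _) _; rewrite normcN Normc.normc1.
rewrite Normc.normcM normc_conj -[leRHS]/(1 + 1) lerD2l.
by rewrite -[leRHS]mulr1 ler_pM ?normc_ge0.
Qed.

Lemma pseudohyp_distE z w : pseudohyp_dist z w = normc (z - w) / normc (1 - z * w^*).
Proof. by rewrite /pseudohyp_dist Normc.normcM Normc.normcV. Qed.

Lemma subr_sqr_gt0 z : normc z < 1 -> 0 < 1 - normc z ^+ 2.
Proof. by move=> z1; rewrite subr_gt0 expr_lt1// normc_ge0. Qed.

Lemma normc_1subM_conj_gt0 z w : normc z < 1 -> normc w < 1 ->
  0 < normc (1 - z * w^*).
Proof.
move=> z1 w1; rewrite lt0r normc_ge0 andbT -sqrf_eq0 gt_eqF//.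
by rewrite sqr_1subM_conj ltr_wpDl ?sqr_ge0// mulr_gt0// subr_sqr_gt0.
Qed.

Lemma one_sub_pseudohyp_sqr z w : normc z < 1 -> normc w < 1 ->
  1 - pseudohyp_dist z w ^+ 2 =
  (1 - normc z ^+ 2) * (1 - normc w ^+ 2) / normc (1 - z * w^*) ^+ 2.
Proof.
move=> z1 w1; have n0 := normc_1subM_conj_gt0 z1 w1.
rewrite pseudohyp_distE expr_div_n -[in LHS](divff (_ : normc (1 - z * w^*) ^+ 2 != 0)).
  by rewrite -mulrBl sqr_1subM_conj addrAC subrr add0r.
by rewrite expf_neq0// gt_eqF.
Qed.

Lemma pseudohyp_dist_ge0 z w : 0 <= pseudohyp_dist z w.
Proof. by rewrite normc_ge0. Qed.

Lemma pseudohyp_dist_lt1 z w : normc z < 1 -> normc w < 1 -> pseudohyp_dist z w < 1.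
Proof.
move=> z1 w1; rewrite -(@expr_lt1 _ 2)// ?pseudohyp_dist_ge0// -subr_gt0.
rewrite one_sub_pseudohyp_sqr//; apply: divr_gt0.
  by apply: mulr_gt0; exact: subr_sqr_gt0.
by apply: exprn_gt0; exact: normc_1subM_conj_gt0.
Qed.

(** The hypothesis says 1 <= A (1 - d^2), and (1 + d) / (1 - d) = (1 + d)^2 / (1 - d^2) <= 4 A. *)
Lemma hyp_dist_le z w (A : R) : normc z < 1 -> normc w < 1 ->
  normc (1 - z * w^*) ^+ 2 <= A * ((1 - normc z ^+ 2) * (1 - normc w ^+ 2)) ->
  hyp_dist z w <= 2^-1 * ln (4 * A).
Proof.
move=> z1 w1 H; rewrite /hyp_dist ler_pM2l ?invr_gt0//.
have d0 := pseudohyp_dist_ge0 z w; have d1 := pseudohyp_dist_lt1 z1 w1.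
set d := pseudohyp_dist z w in d0 d1 *.
have n0 := exprn_gt0 2 (normc_1subM_conj_gt0 z1 w1).
have A1 : 1 <= A * (1 - d ^+ 2).
  by rewrite one_sub_pseudohyp_sqr// mulrA ler_pdivlMr// mul1r.
have d10 : 0 < 1 - d by rewrite subr_gt0.
have A0 : 0 < A.
  have : 0 < A * (1 - d ^+ 2) by apply: lt_le_trans A1.
  by rewrite pmulr_lgt0// subr_gt0 expr_lt1.
rewrite ler_ln ?posrE ?divr_gt0 ?mulr_gt0//; last by rewrite ltr_pwDl.
by rewrite ler_pdivrMr//; nra.
Qed.

(** With k = 1 - r^2, the bound follows from rho <= d / (1 - d), d <= |z - w| / k and 1 - d >= k^2 /
    8. *)
Lemma hyp_dist_lip (r : R) z w : r < 1 -> normc z <= r -> normc w <= r ->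
  hyp_dist z w <= 8 / (1 - r ^+ 2) ^+ 3 * normc (z - w).
Proof.
move=> r1 zr wr.
have z1 := le_lt_trans zr r1; have w1 := le_lt_trans wr r1.
have r0 : 0 <= r by apply: le_trans zr; exact: normc_ge0.
have d0 := pseudohyp_dist_ge0 z w; have d1 := pseudohyp_dist_lt1 z1 w1.
have E := one_sub_pseudohyp_sqr z1 w1; have dE := pseudohyp_distE z w.
rewrite /hyp_dist; set d := pseudohyp_dist z w in d0 d1 E dE *.
set k := 1 - r ^+ 2; have k0 : 0 < k by rewrite subr_gt0 expr_lt1.
have n0 := normc_1subM_conj_gt0 z1 w1.
have n2 := normc_1subM_conj_le2 (ltW z1) (ltW w1).
set n := normc (1 - _) in n0 n2 E dE.
have kz : k <= 1 - normc z ^+ 2 by rewrite lerB// lerXn2r ?nnegrE ?normc_ge0.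
have kw : k <= 1 - normc w ^+ 2 by rewrite lerB// lerXn2r ?nnegrE ?normc_ge0.
have kn : k <= n.
  have : k ^+ 2 <= n ^+ 2.
    rewrite sqr_1subM_conj; have := sqr_ge0 (normc (z - w)); nra.
  by rewrite ler_sqr ?nnegrE//; exact: ltW.
have d10 : 0 < 1 - d by rewrite subr_gt0.
have b1 : k ^+ 2 / 8 <= 1 - d.
  have : k ^+ 2 / 4 <= 1 - d ^+ 2.
    rewrite E ler_pdivlMr ?exprn_gt0//.
    have : n ^+ 2 <= 4 by nra.
    have : k * k <= (1 - normc z ^+ 2) * (1 - normc w ^+ 2) by rewrite ler_pM// ltW.
    move=> h1 h2; apply: le_trans h1.
    by rewrite mulrAC ler_pdivrMr// -expr2 ler_wpM2l ?sqr_ge0.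
  by nra.
have b2 : d <= normc (z - w) / k.
  by rewrite dE ler_wpM2l ?normc_ge0// lef_pV2 ?posrE.
have lnb : ln ((1 + d) / (1 - d)) <= 2 * (d / (1 - d)).
  have -> : (1 + d) / (1 - d) = 1 + 2 * (d / (1 - d)) by field; rewrite gt_eqF.
  have dd0 : 0 <= d / (1 - d) by rewrite divr_ge0// ltW.
  by apply: le_ln1Dx; lra.
apply: (@le_trans _ _ (d / (1 - d))); first by lra.
rewrite ler_pdivrMr//; apply: (le_trans b2).
have -> : normc (z - w) / k = 8 / k ^+ 3 * normc (z - w) * (k ^+ 2 / 8).
  by field; rewrite gt_eqF.
by rewrite ler_wpM2l// mulr_ge0 ?normc_ge0// divr_ge0// exprn_ge0// ltW.
Qed.

Section LogLipschitz.
Variables (u : R[i] -> R) (C : R).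
Hypothesis C0 : 0 <= C.
Hypothesis u_gt0 : forall z, unit_disk z -> 0 < u z.
Hypothesis u_lip : log_lipschitz C u.

Lemma log_lipschitz_le z w (B : R) : normc z < 1 -> normc w < 1 ->
  hyp_dist z w <= B -> u z <= expR (C * B) * u w.
Proof.
move=> /unit_diskE z1 /unit_diskE w1 dB.
have := u_lip z1 w1; rewrite ler_norml => /andP[_].
have : C * hyp_dist z w <= C * B by rewrite ler_wpM2l.
rewrite -[u z in X in _ -> _ -> X]lnK ?posrE ?u_gt0//.
rewrite -[u w in X in _ -> _ -> X]lnK ?posrE ?u_gt0//.
by rewrite -expRD ler_expR; lra.
Qed.

(** Comparison with [u 0] bounds u by [B] on the disk; then 1 + x <= exp x at x = ln u(w) - ln u(z)
    gives u(z) - u(w) <= u(z) (ln u(z) - ln u(w)). This supplies the Lipschitz hypothesis of the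
    Fejer approximation. *)
Lemma log_lipschitz_lip (r : R) : 0 <= r < 1 -> exists2 L : R, 0 <= L &
  forall z w, normc z <= r -> normc w <= r -> `|u z - u w| <= L * normc (z - w).
Proof.
move=> /andP[r0 r1].
pose l := 8 / (1 - r ^+ 2) ^+ 3.
have k0 : 0 < 1 - r ^+ 2 by rewrite subr_gt0 expr_lt1.
have l0 : 0 <= l by rewrite divr_ge0// exprn_ge0// ltW.
pose B := expR (C * (l * r)) * u 0.
have n0 : normc (0 : R[i]) = 0 by exact: Normc.normc0.
have u00 : 0 < u 0 by apply: u_gt0; apply/unit_diskE; rewrite n0.
have B0 : 0 < B by rewrite mulr_gt0// expR_gt0.
exists (B * (C * l)) => [|z w zr wr]; first by rewrite (mulr_ge0 (ltW B0))// mulr_ge0.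
wlog uwz : z w zr wr / u w <= u z.
  move=> H; have /orP[|] := le_total (u w) (u z); first exact: H.
  by move=> uzw; rewrite distrC normc_sub H.
have z1 := le_lt_trans zr r1; have w1 := le_lt_trans wr r1.
rewrite ger0_norm ?subr_ge0//.
have uB : u z <= B.
  apply: (log_lipschitz_le z1); first by rewrite n0.
  apply: (le_trans (hyp_dist_lip r1 zr _)); first by rewrite n0.
  by rewrite subr0 ler_wpM2l.
have := u_lip (proj2 (unit_diskE z) z1) (proj2 (unit_diskE w) w1).
rewrite ler_norml => /andP[_ h1].
have h2 := hyp_dist_lip r1 zr wr.
have h3 : C * hyp_dist z w <= C * (l * normc (z - w)) by rewrite ler_wpM2l.
have uz : 0 < u z by apply: u_gt0; apply/unit_diskE.
have uw : 0 < u w by apply: u_gt0; apply/unit_diskE.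
have h4 : 1 + (ln (u w) - ln (u z)) <= u w / u z.
  by rewrite -[u w / _]lnK ?posrE ?divr_gt0// ln_div ?posrE// expR_ge1Dx.
have h5 : u z * (1 + (ln (u w) - ln (u z))) <= u w.
  by rewrite -ler_pdivlMl// mulrC.
have h6 : ln (u z) - ln (u w) <= C * (l * normc (z - w)) by lra.
have h7 : u z * (ln (u z) - ln (u w)) <= B * (C * (l * normc (z - w))).
  apply: (@le_trans _ _ (u z * (C * (l * normc (z - w))))).
    by rewrite ler_wpM2l// ltW.
  by rewrite ler_wpM2r// (mulr_ge0 C0)// (mulr_ge0 l0)// normc_ge0.
have -> : B * (C * l) * normc (z - w) = B * (C * (l * normc (z - w))) by rewrite -!mulrA.
apply: le_trans h7; move: h5; rewrite mulrDr mulr1 -[ln (u w) - _]opprB mulrN.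
by move=> h5; rewrite lerBlDr addrC -lerBlDr.
Qed.

Lemma log_lipschitz_continuous z : normc z < 1 -> mcontinuous u z.
Proof.
move=> z1 eps eps0; pose r := (1 + normc z) / 2.
have [r0 r1] : 0 <= r /\ r < 1 by have := normc_ge0 z; rewrite /r; lra.
have [|L L0 uL] := @log_lipschitz_lip r; first by rewrite r0.
have L1 : 0 < L + 1 by rewrite ltr_wpDl.
exists (Num.min (r - normc z) (eps / (L + 1))) => [|w].
  by rewrite lt_min divr_gt0// andbT /r; lra.
rewrite lt_min => /andP[w1 w2].
have zr : normc z <= r by rewrite /r; lra.
have wr : normc w <= r.
  have := le_normcD (w - z) z; rewrite subrK; lra.
apply: le_lt_trans (uL _ _ wr zr) _.
move: w2; rewrite ltr_pdivlMr// => w2.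
by apply: le_lt_trans w2; have := normc_ge0 (w - z); nra.
Qed.

End LogLipschitz.
End HyperbolicDistance.

(** * The dyadic balayage *)

Section Disks.
Variable R : realType.
Implicit Types z w : R[i].

Lemma closed_disk (r : R) : 0 <= r ->
  closed [set x : R * R | normc (x.1 +i* x.2) <= r].
Proof.
move=> r0.
have -> : [set x : R * R | normc (x.1 +i* x.2) <= r] =
    (fun x : R * R => x.1 * x.1 + x.2 * x.2) @^-1` [set y | y <= r ^+ 2].
  by apply/seteqP; split=> -[a b]; rewrite /= -/(normc (a +i* b)) normc_le_sqr.
apply: closed_comp; last exact: closed_le.
move=> x _; suff : {for x, continuous (fun x : R * R => x.1 * x.1 + x.2 * x.2)} by [].
have c1 : {for x, continuous (fun x : R * R => x.1)} by exact: cvg_fst.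
have c2 : {for x, continuous (fun x : R * R => x.2)} by exact: cvg_snd.
by apply: continuousD; apply: continuousM.
Qed.

Lemma closed_halfplane (e : R[i]) (c : R) :
  closed [set x : R * R | c <= Re ((x.1 +i* x.2) * e)].
Proof.
have -> : [set x : R * R | c <= Re ((x.1 +i* x.2) * e)] =
    (fun x : R * R => x.1 * Re e - x.2 * Im e) @^-1` [set y | c <= y].
  by apply/seteqP; split=> -[a b]; rewrite /= ReM.
apply: closed_comp; last exact: closed_ge.
move=> x _; suff : {for x, continuous (fun x : R * R => x.1 * Re e - x.2 * Im e)} by [].
have c1 : {for x, continuous (fun x : R * R => x.1)} by exact: cvg_fst.
have c2 : {for x, continuous (fun x : R * R => x.2)} by exact: cvg_snd.
by apply: continuousB; apply: continuousM => //; exact: cst_continuous.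
Qed.

Lemma mcontinuous_cst (c : R) z : mcontinuous (fun=> c) z.
Proof. by move=> e e0; exists 1 => // w _; rewrite subrr normr0. Qed.

Lemma min_disk (u : R[i] -> R) (r : R) (p : {poly R[i]}) : 0 <= r <= 1 ->
  (forall z, normc z <= r -> mcontinuous u z) ->
  (forall z (s : R), 0 < s -> (forall w, normc (w - z) <= s -> normc w <= r) ->
    (circle_mean (EFin \o u) z s <= (u z)%:E)%E) ->
  (forall z, normc z = r -> Re p.[z] <= u z) ->
  forall z, normc z <= r -> Re p.[z] <= u z.
Proof.
move=> /andP[r0 r1] cu um bd z zr.
apply: (@min_principle _ u p [set z | normc z <= r]) => //.
- by move=> w /= wr; apply: le_trans wr r1.
- exact: closed_disk.
move=> w /=; rewrite le_eqVlt => /predU1P[/bd|wr]; first by left.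
right; exists (r - normc w).
have H x : normc (x - w) <= r - normc w -> normc x <= r.
  by move=> h; have := le_normcD (x - w) w; rewrite subrK; lra.
by split => //; [rewrite subr_gt0|apply: um => //; rewrite subr_gt0].
Qed.

Lemma min_disk_poly (r : R) (p : {poly R[i]}) : 0 <= r <= 1 ->
  (forall z, normc z = r -> 0 <= Re p.[z]) ->
  forall z, normc z <= r -> 0 <= Re p.[z].
Proof.
move=> r01 bd z zr; rewrite -oppr_le0 -ReN -hornerN.
apply: (@min_disk (fun=> 0) r (- p)) => //.
- by move=> w _; exact: mcontinuous_cst.
- by move=> w s _ _; rewrite /comp circle_mean0.
- by move=> w wr; rewrite hornerN ReN oppr_le0 bd.
Qed.

Lemma exists_direction z : exists2 e, normc e = 1 & z * e^* = (normc z)%:C.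
Proof.
have [->|z0] := eqVneq z 0.
  by exists 1; rewrite ?Normc.normc1// mul0r Normc.normc0.
have nz : normc z != 0 by apply: contra_neq z0; exact: Normc.eq0_normc.
exists ((normc z)^-1%:C * z).
  by rewrite Normc.normcM normc_real ger0_norm ?invr_ge0 ?normc_ge0// mulVf.
have cr : ((normc z)^-1%:C : R[i])^* = (normc z)^-1%:C by exact: conjc_real.
by rewrite rmorphM [X in _ * (X * _)]cr mulrCA mul_conj -rmorphM/= expr2 mulKf.
Qed.

(* The barrier is kappa Re (((w e' - c) / 2d)^2), where z = |z| e, e' is the
   conjugate of e, d = r - |z| and c = |z| - d, on the part Re (w e') >= c of the
   disk |w| <= r: it is at most kappa, it is positive only in a sector that meets
   |w| = r within 3d of z, and it equals kappa / 4 at z. *)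
Lemma boundary_lower_bound (r kappa : R) (p : {poly R[i]}) z :
  0 <= r <= 1 -> 0 <= kappa -> normc z < r ->
  (forall w, normc w <= r -> 0 <= Re p.[w]) ->
  (forall w, normc w = r -> normc (w - z) <= 3 * (r - normc z) ->
    kappa <= Re p.[w]) ->
  kappa / 4 <= Re p.[z].
Proof.
move=> /andP[r0 r1] k0 zr p0 pk.
have [e e1 ze] := exists_direction z.
pose d := r - normc z; have d0 : 0 < d by rewrite subr_gt0.
pose c := normc z - d.
pose B : {poly R[i]} := (kappa / (2 * d) ^+ 2)%:C *: (e^* *: 'X - c%:C%:P) ^+ 2.
have BE w : Re B.[w] =
    kappa / (2 * d) ^+ 2 * ((Re (w * e^*) - c) ^+ 2 - Im (w * e^*) ^+ 2).
  rewrite /B !(hornerZ, horner_exp, hornerD, hornerN, hornerC, hornerX) ReZ.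
  congr *%R; rewrite [e^* * w]mulrC; move: (w * e^*) => x.
  by rewrite [in LHS]expr2 ReM; case: x => a b /=; rewrite oppr0 addr0 -!expr2.
pose K := [set w : R[i] | normc w <= r /\ c <= Re (w * e^*)].
have kd0 : 0 <= kappa / (2 * d) ^+ 2 by rewrite divr_ge0// sqr_ge0.
have B_le0 w : normc w <= r -> (Re (w * e^*) - c) ^+ 2 <= Im (w * e^*) ^+ 2 ->
    Re (B - p).[w] <= 0.
  move=> wr h; rewrite hornerD hornerN ReB BE.
  have := p0 _ wr.
  have : kappa / (2 * d) ^+ 2 * ((Re (w * e^*) - c) ^+ 2 - Im (w * e^*) ^+ 2) <= 0.
    by rewrite mulr_ge0_le0// subr_le0.
  by lra.
have nwe w : normc (w * e^*) = normc w by rewrite Normc.normcM normc_conj e1 mulr1.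
suff H : Re (B - p).[z] <= 0.
  move: H; rewrite hornerD hornerN ReB BE ze /= /c.
  have -> : kappa / (2 * d) ^+ 2 * ((normc z - (normc z - d)) ^+ 2 - 0 ^+ 2) = kappa / 4.
    by field; rewrite gt_eqF.
  by lra.
apply: (@min_principle _ (fun=> 0) (B - p) K).
- by move=> w [wr _]; apply: le_trans wr r1.
- have -> : [set x : R * R | K (x.1 +i* x.2)] = [set x | normc (x.1 +i* x.2) <= r] `&`
      [set x | c <= Re ((x.1 +i* x.2) * e^*)] by [].
  by apply: closedI; [exact: closed_disk|exact: closed_halfplane].
- by move=> w _; exact: mcontinuous_cst.
- move=> w [wr wc].
  (* Three cases: on the chord the barrier is nonpositive, on the arc it is nonpositive or [pk]
     applies, and an interior point has a small disk inside K. *)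
  have [wc'|wc'] := leP (Re (w * e^*)) c.
    left; apply: B_le0 => //.
    have -> : Re (w * e^*) = c by apply/eqP; rewrite eq_le wc wc'.
    by rewrite subrr expr0n sqr_ge0.
  move: wr; rewrite le_eqVlt => /predU1P[wr|wr].
    left; have [h|h] := leP ((Re (w * e^*) - c) ^+ 2) (Im (w * e^*) ^+ 2).
      by apply: B_le0 => //; rewrite wr.
    have xr : Re (w * e^*) <= r by rewrite -wr -nwe (le_trans (ler_norm _))// normc_Re.
    have x0 : 0 <= Re (w * e^*) - c by rewrite subr_ge0.
    have yx : `|Im (w * e^*)| <= Re (w * e^*) - c.
      by rewrite -ler_sqr ?nnegrE// real_normK ?num_real// ltW.
    have cr : Re (w * e^*) - c <= 2 * d by rewrite /c /d; lra.
    (* After rotation the real part lies between |z| - d and |z| + d = r, which costs d, and the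
       imaginary part is at most 2d in modulus. *)
    have wz : normc (w - z) <= 3 * d.
      rewrite -nwe mulrBl ze (le_trans (normc_le_ReIm _))// ReB ImB /= subr0.
      have : `|Re (w * e^*) - normc z| <= d.
        by rewrite ler_norml; move: x0 cr; rewrite /c; lra.
      by lra.
    have := pk _ wr wz; rewrite hornerD hornerN ReB BE.
    have : kappa / (2 * d) ^+ 2 * ((Re (w * e^*) - c) ^+ 2 - Im (w * e^*) ^+ 2) <= kappa.
      rewrite -[leRHS]mulr1 -mulrA ler_wpM2l// mulrC ler_pdivrMr ?exprn_gt0 ?mulr_gt0// mul1r.
      have : (Re (w * e^*) - c) ^+ 2 <= (2 * d) ^+ 2.
        by rewrite ler_sqr ?nnegrE// (le_trans x0).
      by have := sqr_ge0 (Im (w * e^*)); lra.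
    by lra.
  right; exists (Num.min (r - normc w) (Re (w * e^*) - c)); split.
  + by rewrite lt_min !subr_gt0 wr.
  + move=> x; rewrite le_min => /andP[h1 h2]; split.
      by have := le_normcD (x - w) w; rewrite subrK; lra.
    have := normc_Re ((w - x) * e^*); rewrite nwe mulrBl ReB normc_sub.
    by move=> /(le_trans (ler_norm _)); lra.
  + by rewrite /comp circle_mean0.
- split; first exact: ltW.
  by rewrite ze /= /c; lra.
Qed.

End Disks.

(** * Polynomial approximation on dyadic circles and the sums H_N *)

Section Approximation.
Variable R : realType.
Implicit Types z w : R[i].

Definition rad n : R := 1 - 2^-1 ^+ n.+1.

Lemma half_gt0 n : 0 < 2^-1 ^+ n :> R.
Proof. by rewrite exprn_gt0// invr_gt0. Qed.

Lemma half_le m n : (m <= n)%N -> 2^-1 ^+ n <= 2^-1 ^+ m :> R.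
Proof. by move=> mn; rewrite ler_wiXn2l// ?invr_ge0// invf_le1// ler1n. Qed.

Lemma rad_lt1 n : rad n < 1.
Proof. by rewrite ltrBlDr ltrDl half_gt0. Qed.

Lemma rad_ge_half n : 2^-1 <= rad n.
Proof. by have := half_le (ltn0Sn n); rewrite /rad expr1; lra. Qed.

Lemma rad_gt0 n : 0 < rad n.
Proof. by apply: lt_le_trans (rad_ge_half n); rewrite invr_gt0. Qed.

Lemma rad_le m n : (m <= n)%N -> rad m <= rad n.
Proof. by move=> mn; rewrite lerB// half_le. Qed.

Lemma rad_le1 n : 0 <= rad n <= 1.
Proof. by rewrite ltW ?rad_gt0// ltW// rad_lt1. Qed.

Lemma exists_half_lt (x : R) : 0 < x -> exists n, 2^-1 ^+ n <= x.
Proof.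
move=> x0; exists (Num.truncn x^-1).+1.
rewrite exprVn -[leRHS]invrK lef_pV2 ?posrE ?invr_gt0 ?exprn_gt0//.
rewrite (le_trans (ltW (truncnS_gt _)))//.
by rewrite -natrX ler_nat ltnW// ltn_expl.
Qed.

(** The least m with the first inequality works: minimality gives the second one, which for m = 0
    only says 1 - |z| <= 1. *)
Lemma rad_cover z : normc z < 1 ->
  exists m, 2^-1 ^+ m.+1 <= 1 - normc z <= 2 * 2^-1 ^+ m.+1.
Proof.
move=> z1.
have ex : exists m, 2^-1 ^+ m.+1 <= 1 - normc z.
  have [|n h] := @exists_half_lt (1 - normc z); first by rewrite subr_gt0.
  by exists n; apply: le_trans h; exact: half_le.
exists (ex_minn ex); case: ex_minnP => -[|m] h minm; rewrite h/=.
  by rewrite expr1 divff// lerBlDr lerDl normc_ge0.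
rewrite exprS mulrA divff// mul1r leNgt; apply/negP => hm.
by have := minm m (ltW hm); rewrite ltnn.
Qed.

Definition dilate (r : R) (p : {poly R[i]}) := p \Po (r%:C *: 'X).

Lemma horner_dilate r p z : (dilate r p).[z] = p.[r%:C * z].
Proof. by rewrite /dilate horner_comp hornerZ hornerX. Qed.

Lemma normcZ (r : R) z : 0 <= r -> normc (r%:C * z) = r * normc z.
Proof. by move=> r0; rewrite Normc.normcM normc_real ger0_norm. Qed.

Variables (u : R[i] -> R) (C : R).
Hypothesis C0 : 0 <= C.
Hypothesis u_gt0 : forall z, unit_disk z -> 0 < u z.
Hypothesis u_lip : log_lipschitz C u.
Hypothesis u_mean : forall z (r : R), 0 < r ->
  [set w | `|w - z| <= r%:C] `<=` @unit_disk R ->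
  (circle_mean (fun z => (u z)%:E) z r <= (u z)%:E)%E.

(** The lower margin at n equals the upper margin at n + 1, which is what makes consecutive
    differences nonnegative. *)
Lemma circle_approx n : exists p : {poly R[i]}, forall z, normc z = rad n ->
  u z + 2^-1 ^+ n.+1 <= Re p.[z] <= u z + 2^-1 ^+ n.
Proof.
have r0 := rad_gt0 n; have r1 := rad_lt1 n.
have [|L L0 uL] := @log_lipschitz_lip _ u C C0 u_gt0 u_lip (rad n).
  by rewrite r1 ltW.
(* The target is the middle of the band, and the tolerance is half its width 2^-(n+1). *)
pose f z := u ((rad n)%:C * z) + 3 / 2 * 2^-1 ^+ n.+1.
have [||z w z1 w1|p pE] := @fejer_approx R f (L * rad n) (2^-1 * 2^-1 ^+ n.+1).
- by rewrite mulr_ge0// ltW.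
- by rewrite mulr_gt0 ?half_gt0// invr_gt0.
- rewrite /f opprD addrACA subrr addr0 -mulrA -normcZ ?mulrBr ?(ltW r0)//.
  by apply: uL; rewrite normcZ ?(ltW r0)// ?z1 ?w1 mulr1.
exists (dilate (rad n)^-1 p) => z zr.
have rC : (rad n)%:C * ((rad n)^-1%:C * z) = z.
  by rewrite mulrA -rmorphM/= divff ?mul1r// gt_eqF.
have := pE ((rad n)^-1%:C * z); rewrite normcZ ?invr_ge0 ?(ltW r0)// zr mulVf ?gt_eqF//.
rewrite /f rC horner_dilate ler_norml => /(_ erefl)/andP[].
by rewrite [2^-1 ^+ n.+1]exprS; have := half_gt0 n; lra.
Qed.

Lemma mean_disk (r : R) : r < 1 ->
  forall z (s : R), 0 < s -> (forall w, normc (w - z) <= s -> normc w <= r) ->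
    (circle_mean (fun z => (u z)%:E) z s <= (u z)%:E)%E.
Proof.
move=> r1 z s s0 h; apply: u_mean => // w /=.
by rewrite normrC lecR => /h wr; apply/unit_diskE; exact: le_lt_trans r1.
Qed.

Lemma le_disk (r c : R) (p : {poly R[i]}) : 0 <= r < 1 ->
  (forall z, normc z = r -> Re p.[z] <= u z + c) ->
  forall z, normc z <= r -> Re p.[z] <= u z + c.
Proof.
move=> /andP[r0 r1] bd z zr; rewrite -lerBlDr.
have E w : Re p.[w] - c = Re (p - c%:C%:P).[w].
  by rewrite hornerD hornerN hornerC ReD ReN.
rewrite E; apply: (@min_disk _ u r _) zr.
- by rewrite r0 ltW.
- move=> w wr; apply: (log_lipschitz_continuous C0 u_gt0 u_lip).
  exact: le_lt_trans r1.
- by move=> w s s0 h; apply: (@mean_disk r).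
- by move=> w wr; rewrite -E lerBlDr bd.
Qed.

(** This is all that the limit argument needs from u: nonnegativity on the circle and the bound at 0
    give compactness, and the domination of u, from some N0 depending on z, passes to the limit. *)
Lemma harmonic_polynomials : exists (K M : R) (q : nat -> {poly R[i]}),
  [/\ 0 < K,
      forall N z, normc z = 1 -> 0 <= Re (q N).[z],
      forall N, Re (q N)`_0 <= M
    & forall z, normc z < 1 -> exists N0, forall N, (N0 <= N)%N ->
        u z <= K * Re (q N).[z]].
Proof.
(* Below, [p], [g] and [q] are v, g and H of the overview. *)
have [p pE] := choice circle_approx.
have p_le n z : normc z <= rad n -> Re (p n).[z] <= u z + 2^-1 ^+ n.
  apply: le_disk; first by rewrite rad_lt1 ltW ?rad_gt0.
  by move=> w /pE/andP[].
have p_ge n z : normc z = rad n -> u z <= Re (p n).[z].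
  by move=> /pE/andP[h _]; have := half_gt0 n.+1; lra.
have u_pos n z : normc z <= rad n -> 0 < u z.
  by move=> zr; apply/u_gt0/unit_diskE; apply: le_lt_trans (rad_lt1 n).
have p_ge0 n z : normc z <= rad n -> 0 <= Re (p n).[z].
  apply: min_disk_poly; first exact: rad_le1.
  by move=> w wr; apply: le_trans (p_ge _ _ wr); apply/ltW/(u_pos n); rewrite wr.
pose g n := p n - p n.+1.
have g_ge0 n z : normc z <= rad n -> 0 <= Re (g n).[z].
  apply: min_disk_poly; first exact: rad_le1.
  move=> w wr; rewrite hornerD hornerN ReB subr_ge0.
  have /andP[h _] := pE _ _ wr; apply: le_trans h; apply: p_le.
  by rewrite wr rad_le.
have dil n z : normc z <= 1 -> normc ((rad n)%:C * z) <= rad n.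
  by move=> z1; rewrite normcZ ?(ltW (rad_gt0 n))// ler_piMr// ltW ?rad_gt0.
pose q N := dilate (rad N) (p N) + \sum_(0 <= n < N) dilate (rad n) (g n).
have qE N z : Re (q N).[z] = Re (p N).[(rad N)%:C * z] +
    \sum_(0 <= n < N) Re (g n).[(rad n)%:C * z].
  rewrite /q hornerD horner_sum ReD Re_sum horner_dilate; congr +%R.
  by apply: eq_bigr => n _; rewrite horner_dilate.
(* [K1] is the ratio allowed to u between z and the nearby arc. The 144 comes from |1 - z conj w|^2
   <= 36 s^2 and (1 - |z|^2)(1 - |w|^2) >= s^2 / 4. *)
pose K1 : R := expR (C * (2^-1 * ln (4 * 144))).
(* The factor 12 is 4 from the barrier times 3 from Harnack; the bound at 0 is [p 0] <= u + 2^0. *)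
exists (12 * K1), (u 0 + 1), q; split.
- by rewrite mulr_gt0// expR_gt0.
- move=> N z z1; rewrite qE addr_ge0 ?p_ge0 ?dil ?z1//.
  by rewrite sumr_ge0// => n _; rewrite g_ge0 ?dil ?z1.
(* Dilations fix 0, so at 0 the sum telescopes to [p 0]. *)
- move=> N; rewrite -horner_coef0 qE mulr0.
  have -> : \sum_(0 <= n < N) Re (g n).[(rad n)%:C * 0] =
      \sum_(0 <= n < N) (Re (p n).[0] - Re (p n.+1).[0]).
    by apply: eq_bigr => n _; rewrite mulr0 hornerD hornerN ReB.
  rewrite -[X in _ + X]opprK -sumrN.
  under eq_bigr do rewrite opprB.
  rewrite telescope_sumr// opprB addrCA subrr addr0.
  by have := p_le 0%N 0; rewrite expr0 Normc.normc0 ltW ?rad_gt0//; apply.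
move=> z z1; have [m /andP[s1 s2]] := rad_cover z1.
set s := 2^-1 ^+ m.+1 in s1 s2.
have s0 : 0 < s by exact: half_gt0.
(* This choice gives 1 - [rad k] = s / 4 with s <= 1 - |z|. So z lies inside the circle, and for n
   >= k, |z - r_n z| <= s / 4 <= r_n (1 - |z|) / 2, since r_n >= 1/2. *)
pose k := m.+2.
have rk : rad k = 1 - s / 4 by rewrite /rad /k /s 2!exprS; field.
have zk : normc z < rad k by rewrite rk; lra.
have uz0 : 0 < u z by apply/u_gt0/unit_diskE.
have K10 : 0 < K1 by exact: expR_gt0.
have low : u z / K1 / 4 <= Re (p k).[z].
  apply: (@boundary_lower_bound _ (rad k)) => //.
  - exact: rad_le1.
  - by rewrite divr_ge0// ltW.
  - exact: p_ge0.
  move=> w wr wz; apply: le_trans (p_ge _ _ wr).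
  rewrite ler_pdivrMr// mulrC.
  have w1 : normc w < 1 by rewrite wr rad_lt1.
  apply: (log_lipschitz_le C0 u_gt0 u_lip) => //; apply: hyp_dist_le => //.
  (* The first term 1 - |w|^2 is at most s / 2, and |w - z| <= 3 (r_k - |z|) <= 3 (2 s - s / 4). *)
  have h1 : normc (1 - z * w^*) <= 6 * s.
    have -> : 1 - z * w^* = (1 - normc w ^+ 2)%:C + (w - z) * w^*.
      by rewrite mulrBl mul_conj rmorphB/= rmorph1 addrA subrK.
    apply: le_trans (le_normcD _ _) _; rewrite normc_real ger0_norm; last first.
      by rewrite subr_ge0 exprn_ile1// ?normc_ge0// ltW.
    rewrite Normc.normcM normc_conj.
    have : normc (w - z) * normc w <= normc (w - z).
      by rewrite ler_piMr ?normc_ge0// ltW.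
    have := sqr_ge0 (1 - normc w); have := normc_ge0 w.
    by move: wz; rewrite wr rk; nra.
  have h2 : normc (1 - z * w^*) ^+ 2 <= (6 * s) ^+ 2.
    by rewrite lerXn2r ?nnegrE ?normc_ge0// mulr_ge0// ltW.
  apply: (le_trans h2).
  have h3 : s <= 1 - normc z ^+ 2 by have := normc_ge0 z; nra.
  have h4 : s / 4 <= 1 - normc w ^+ 2.
    by have := normc_ge0 w; rewrite wr rk; have := rad_gt0 k; rewrite rk; nra.
  have : s * (s / 4) <= (1 - normc z ^+ 2) * (1 - normc w ^+ 2).
    by apply: ler_pM => //; [exact: ltW|rewrite divr_ge0// ltW].
  by nra.
exists k => N kN.
have har n (f : {poly R[i]}) : (k <= n)%N ->
    (forall w, normc w <= rad n -> 0 <= Re f.[w]) ->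
    Re f.[z] <= 3 * Re f.[(rad n)%:C * z].
  move=> kn f0; have rn0 := rad_gt0 n; have rn1 := rad_lt1 n.
  have rn2 := rad_ge_half n.
  (* The disk of this radius about r_n z is contained in |w| <= r_n. *)
  apply: (@harnack _ f _ (rad n * (1 - normc z))).
  - by rewrite mulr_ge0 ?(ltW rn0)// subr_ge0 ltW.
  - move=> w h; apply: f0; have := le_normcD (w - (rad n)%:C * z) ((rad n)%:C * z).
    by rewrite subrK normcZ ?(ltW rn0)//; nra.
  - have -> : z - (rad n)%:C * z = (1 - rad n)%:C * z.
      by rewrite [(1 - rad n)%:C]rmorphB/= rmorph1 mulrBl mul1r.
    rewrite normcZ ?subr_ge0 ?(ltW rn1)//.
    have := rad_le kn; rewrite rk => h.
    have : (1 - rad n) * normc z <= 1 - rad n by rewrite ler_piMr ?subr_ge0 ?ltW.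
    by nra.
have tele : Re (p k).[z] = Re (p N).[z] + \sum_(k <= n < N) Re (g n).[z].
  have -> : \sum_(k <= n < N) Re (g n).[z] =
      \sum_(k <= n < N) (Re (p n).[z] - Re (p n.+1).[z]).
    by apply: eq_bigr => n _; rewrite hornerD hornerN ReB.
  rewrite -[X in _ + X]opprK -sumrN.
  under eq_bigr do rewrite opprB.
  by rewrite telescope_sumr// opprB addrCA subrr addr0.
have up : Re (p k).[z] <= 3 * Re (q N).[z].
  rewrite tele qE mulrDr; apply: lerD; first exact: har (p_ge0 N).
  (* The terms with n < k are nonnegative and are dropped; Harnack applies to each of the others. *)
  rewrite (big_cat_nat (leq0n k) kN)/= mulrDr.
  apply: ler_wpDl.
    rewrite mulr_ge0// sumr_ge0// => n _; apply: g_ge0; apply: dil; exact: ltW.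
  rewrite mulr_sumr; apply: ler_sum_nat => n /andP[kn _].
  exact: har (g_ge0 n).
have := le_trans low up.
by rewrite ler_pdivrMr// ler_pdivrMr//; lra.
Qed.

End Approximation.

(** * Harmonic functions as real parts of power series *)

Section PowerSeries.
Variable R : realType.
Implicit Types (z w h : R[i]) (c : nat -> R[i]) (t : nat -> R).

Lemma geometric_dominated t (B x : R) : 0 <= x < 1 ->
  (forall k, `|t k| <= B * x ^+ k) ->
  cvgn (series t) /\ `|limn (series t)| <= B / (1 - x).
Proof.
move=> /andP[x0 x1] tB.
have x1' : `|x| < 1 by rewrite ger0_norm.
have B0 : 0 <= B by apply: le_trans (normr_ge0 (t 0%N)) _; rewrite (le_trans (tB 0%N))// expr0 mulr1.
have cg := is_cvg_geometric_series (a := B) x1'.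
have cn : cvgn [normed series t].
  apply: (@series_le_cvg R (fun n => `|t n|) (geometric B x)) => // n.
  by rewrite /geometric /= mulr_ge0 ?exprn_ge0.
split; first exact: (@normed_cvg _ R^o).
apply: le_trans (@lim_series_norm _ R^o _ cn) _.
rewrite -(cvg_lim (@Rhausdorff R) (cvg_geometric_series (a := B) x1')).
exact: lim_series_le.
Qed.

(** This says that the radius of convergence is at least 1. Unlike boundedness of the coefficients,
    it is stable under differentiation. *)
Definition tempered c := forall r : R, 0 <= r < 1 ->
  exists B : R, forall k, normc (c k) * r ^+ k <= B.

Lemma bounded_tempered c (B : R) : (forall k, normc (c k) <= B) -> tempered c.
Proof.
move=> cB r /andP[r0 r1]; exists B => k; apply: le_trans (cB k).
by rewrite ler_piMr ?normc_ge0// exprn_ile1// ltW.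
Qed.

(** Each of the k terms of 1 + x + ... + x^(k-1) is at least x^k. *)
Lemma mulrn_expr_le (x : R) k : 0 <= x < 1 -> k%:R * x ^+ k <= (1 - x)^-1.
Proof.
move=> /andP[x0 x1]; have x10 : 0 < 1 - x by rewrite subr_gt0.
rewrite -[leRHS]mul1r ler_pdivlMr//.
have H : k%:R * x ^+ k <= \sum_(j < k) x ^+ j.
  rewrite -[k in k%:R]card_ord mulr_natl -sumr_const; apply: ler_sum => j _.
  by rewrite ler_wiXn2l ?(ltW x1)// ltnW.
apply: (@le_trans _ _ ((\sum_(j < k) x ^+ j) * (1 - x))).
  by rewrite ler_wpM2r// ltW.
rewrite -opprB mulrN mulrC -subrX1 opprB.
by rewrite lerBlDr lerDl exprn_ge0.
Qed.

(** A radius s between r and 1 leaves a factor (r / s)^k, which absorbs k. *)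
Lemma tempered_mulrn c : tempered c -> tempered (fun k => (k%:R)%:C * c k).
Proof.
move=> tc r /andP[r0 r1]; pose s := (1 + r) / 2.
have [s0 s1 rs] : [/\ 0 < s, s < 1 & r < s] by rewrite /s; split; lra.
have [|B BE] := tc s; first by rewrite ltW.
exists (B * (1 - r / s)^-1) => k.
rewrite Normc.normcM normc_real ger0_norm//.
have -> : k%:R * normc (c k) * r ^+ k = (normc (c k) * s ^+ k) * (k%:R * (r / s) ^+ k).
  have -> : r ^+ k = s ^+ k * (r / s) ^+ k by rewrite -exprMn mulrC divfK// gt_eqF.
  by move: (s ^+ k) ((r / s) ^+ k) => a b; ring.
apply: ler_pM => //.
- by rewrite mulr_ge0 ?normc_ge0// exprn_ge0// ltW.
- by rewrite mulr_ge0// exprn_ge0// divr_ge0// ltW.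
- by apply: mulrn_expr_le; rewrite divr_ge0 ?(ltW s0)//= ltr_pdivrMr// mul1r.
Qed.

Lemma tempered_shift c : tempered c -> tempered (fun k => c k.+1).
Proof.
move=> tc r /andP[r0 r1]; pose s := (1 + r) / 2.
have [s0 s1 rs] : [/\ 0 < s, s < 1 & r < s] by rewrite /s; split; lra.
have [|B BE] := tc s; first by rewrite ltW.
exists (B / s) => k; rewrite ler_pdivlMr//.
apply: le_trans (BE k.+1); rewrite exprSr [leRHS]mulrA ler_wpM2r ?(ltW s0)//.
by rewrite ler_wpM2l ?normc_ge0// lerXn2r ?nnegrE ?(ltW s0)// ltW.
Qed.

Lemma tempered_mul c h : tempered c -> tempered (fun k => h * c k).
Proof.
move=> tc r /tc[B BE]; exists (normc h * B) => k.
by rewrite Normc.normcM -mulrA ler_wpM2l ?normc_ge0.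
Qed.

Lemma tempered_decay c (r : R) : tempered c -> 0 <= r < 1 ->
  exists B x : R, [/\ 0 <= B, 0 <= x < 1 & forall k, normc (c k) * r ^+ k <= B * x ^+ k].
Proof.
move=> tc /andP[r0 r1]; pose s := (1 + r) / 2.
have [s0 s1 rs] : [/\ 0 < s, s < 1 & r < s] by rewrite /s; split; lra.
have [|B BE] := tc s; first by rewrite ltW.
exists B, (r / s); split.
- by apply: le_trans (BE 0%N); rewrite mulr_ge0 ?normc_ge0// exprn_ge0// ltW.
- by rewrite divr_ge0 ?(ltW s0)//= ltr_pdivrMr// mul1r.
move=> k; rewrite expr_div_n mulrA ler_pdivlMr ?exprn_gt0// mulrAC.
by rewrite ler_wpM2r// exprn_ge0.
Qed.

(** Only a real series is summed. The value is meaningful for tempered c and |z| < 1, and may be a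
    default elsewhere. *)
Definition re_psum c z : R := limn (series (fun k => Re (c k * z ^+ k))).

Lemma re_psum_dominated c z : tempered c -> normc z < 1 ->
  cvgn (series (fun k => Re (c k * z ^+ k))).
Proof.
move=> tc z1; have [|B [x [B0 x01 H]]] := @tempered_decay c (normc z) tc.
  by rewrite normc_ge0.
suff : forall k, `|Re (c k * z ^+ k)| <= B * x ^+ k by case/(geometric_dominated x01).
move=> k; apply: le_trans (H k); apply: le_trans (normc_Re _) _.
by rewrite Normc.normcM normcX.
Qed.

Definition cderive c : nat -> R[i] := fun k => (k.+1%:R)%:C * c k.+1.

Lemma tempered_derive c : tempered c -> tempered (cderive c).
Proof. by move=> /tempered_mulrn/tempered_shift. Qed.

(** The linear terms of [expr_taylor] are summed here; reindexing drops k = 0, whose factor [k%:R]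
    is 0. *)
Lemma re_psum_derive c z h : tempered c -> normc z < 1 ->
  cvgn (series (fun k => Re (c k * (k%:R%:C * h * z ^+ k.-1)))) /\
  limn (series (fun k => Re (c k * (k%:R%:C * h * z ^+ k.-1)))) =
  re_psum (fun k => h * cderive c k) z.
Proof.
move=> tc z1.
have cv := re_psum_dominated (tempered_mul h (tempered_derive tc)) z1.
suff H : series (fun k => Re (c k * (k%:R%:C * h * z ^+ k.-1))) @ \oo -->
    re_psum (fun k => h * cderive c k) z.
  by split; [apply: cvgP H|apply: cvg_lim H].
rewrite -cvg_shiftS; apply: cvg_trans cv; apply: near_eq_cvg; near=> n.
rewrite /= /series /= big_nat_recl// mul0r mul0r mulr0 add0r.
by apply: eq_bigr => k _; rewrite /cderive /=; congr Re; ring.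
Unshelve. all: by end_near. Qed.

(* For k = 0 the junk exponent k.-1 is harmless: its coefficient is 0. *)
Lemma expr_taylor z h (rho : R) k : normc z <= rho -> normc (z + h) <= rho ->
  rho ^+ 2 * normc ((z + h) ^+ k - z ^+ k - k%:R%:C * h * z ^+ k.-1) <=
  normc h ^+ 2 * k%:R ^+ 2 * rho ^+ k.
Proof.
move=> zr zhr; have r0 : 0 <= rho by apply: le_trans zr; exact: normc_ge0.
elim: k => [|k IH].
  by rewrite !expr0 subrr mul0r mul0r subrr Normc.normc0 mulr0 expr0n mulr0 mul0r.
(* The remainder at k + 1 is z + h times the remainder at k, plus k h^2 z^(k-1); the induction
   closes because k^2 + k <= (k + 1)^2. *)
have -> : (z + h) ^+ k.+1 - z ^+ k.+1 - k.+1%:R%:C * h * z ^+ k =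
  (z + h) * ((z + h) ^+ k - z ^+ k - k%:R%:C * h * z ^+ k.-1) +
  k%:R%:C * h ^+ 2 * z ^+ k.-1.
  case: k {IH} => [|k]; first by rewrite !expr0 !expr1; ring.
  by rewrite -natr1 rmorphD rmorph1 /= !exprS; ring.
have h0 := normc_ge0 h.
have b1 : normc (k%:R%:C * h ^+ 2 * z ^+ k.-1) * rho <= k%:R * normc h ^+ 2 * rho ^+ k.
  rewrite !Normc.normcM normc_real ger0_norm// !normcX.
  case: k {IH} => [|k]; first by rewrite !mul0r.
  rewrite -expr2 [rho ^+ _]exprSr [leRHS]mulrA; apply: ler_wpM2r => //.
  apply: ler_wpM2l; first by rewrite mulr_ge0// exprn_ge0.
  by rewrite lerXn2r ?nnegrE ?normc_ge0.
set D := _ - _ - _ in IH *.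
have b2 : normc ((z + h) * D) <= rho * normc D.
  by rewrite Normc.normcM ler_wpM2r ?normc_ge0.
apply: (@le_trans _ _ (rho ^+ 2 * (rho * normc D + normc (k%:R%:C * h ^+ 2 * z ^+ k.-1)))).
  rewrite ler_wpM2l ?sqr_ge0// (le_trans (le_normcD _ _))// lerD2r//.
rewrite mulrDr.
have b3 := ler_wpM2l r0 IH.
have b4 := ler_wpM2l r0 b1.
have b5 : 0 <= normc h ^+ 2 * rho ^+ k.+1 * (k%:R + 1).
  by rewrite mulr_ge0 ?addr_ge0// mulr_ge0 ?exprn_ge0.
have -> : normc h ^+ 2 * k.+1%:R ^+ 2 * rho ^+ k.+1 =
   rho * (normc h ^+ 2 * k%:R ^+ 2 * rho ^+ k) +
   rho * (k%:R * normc h ^+ 2 * rho ^+ k) +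
   normc h ^+ 2 * rho ^+ k.+1 * (k%:R + 1).
  rewrite -natr1 [rho ^+ k.+1]exprS.
  by move: (k%:R : R) (rho ^+ k) (normc h) => a b x; ring.
apply: ler_wpDr => //.
rewrite (_ : rho ^+ 2 * (rho * normc D) = rho * (rho ^+ 2 * normc D)); last by ring.
by apply: lerD => //; apply: le_trans b4; rewrite le_eqVlt; apply/orP; left; apply/eqP; ring.
Qed.

(** The termwise bounds of [expr_taylor] are summable because k^2 |c_k| r^k still decays
    geometrically. *)
Lemma re_psum_taylor c (r : R) : tempered c -> 0 < r < 1 ->
  exists2 A : R, 0 <= A & forall z h, normc z <= r -> normc (z + h) <= r ->
    `|re_psum c (z + h) - re_psum c z - re_psum (fun k => h * cderive c k) z|
       <= A * normc h ^+ 2.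
Proof.
move=> tc /andP[r0 r1].
have [|B [x [B0 x01 H]]] :=
    @tempered_decay _ r (tempered_mulrn (tempered_mulrn tc)); first by rewrite ltW.
exists (B / r ^+ 2 / (1 - x)) => [|z h zr zhr].
  have /andP[_ x1] := x01.
  by rewrite divr_ge0 ?divr_ge0 ?sqr_ge0// subr_ge0 ltW.
have z1 := le_lt_trans zr r1; have zh1 := le_lt_trans zhr r1.
have c1 := re_psum_dominated tc zh1; have c2 := re_psum_dominated tc z1.
have [c3 E] := re_psum_derive h tc z1.
rewrite -E /re_psum -(lim_seriesB c1 c2) -(lim_seriesB (is_cvg_seriesB c1 c2) c3).
have -> : B / r ^+ 2 / (1 - x) * normc h ^+ 2 = (B / r ^+ 2 * normc h ^+ 2) / (1 - x).
  by rewrite mulrAC.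
apply: (proj2 (geometric_dominated x01 _)) => k.
rewrite !fctE -!ReB -!mulrBr; apply: le_trans (normc_Re _) _.
have := expr_taylor k zr zhr; set D := _ - _ - _ => T.
rewrite Normc.normcM.
have r20 : 0 < r ^+ 2 by rewrite exprn_gt0.
rewrite -(ler_pM2l r20) mulrCA.
apply: (le_trans (ler_wpM2l (normc_ge0 _) T)).
have := H k; rewrite !Normc.normcM !normc_real !ger0_norm// => H'.
have h20 : 0 <= normc h ^+ 2 by exact: sqr_ge0.
have := ler_wpM2r h20 H'.
rewrite (_ : r ^+ 2 * (B / r ^+ 2 * normc h ^+ 2 * x ^+ k) = B * x ^+ k * normc h ^+ 2).
  by apply: le_trans; rewrite le_eqVlt; apply/orP; left; apply/eqP; ring.
by field; rewrite gt_eqF.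
Qed.

End PowerSeries.

(** * Harmonicity of the real part of a power series *)

Section Harmonicity.
Variable R : realType.
Implicit Types (z w h v : R[i]) (c : nat -> R[i]).

Lemma nbhs_disk z (P : R[i] -> Prop) (d : R) : 0 < d ->
  (forall w, normc (w - z) < d -> P w) -> \forall w \near (z : R[i]^o), P w.
Proof.
move=> d0 H; apply/nbhs_normP; exists d%:C; first by rewrite /= ltcR.
by move=> w /=; rewrite /ball_ /= normrC ltcR normc_sub; exact: H.
Qed.

Lemma mcontinuous_continuous (f : R[i] -> R) z :
  mcontinuous f z -> {for z, continuous (f : R[i]^o -> R)}.
Proof.
move=> cf; have FF : Filter (nbhs (z : R[i]^o)) by exact: nbhs_filter.
have [_] := @cvgrPdist_lt _ _ _ (nbhs (z : R[i]^o)) FF f (f z).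
apply => e /cf[d d0 H].
by apply: (nbhs_disk d0) => w /H; rewrite distrC.
Qed.

(** These are the coefficients of v f', whose real part is the derivative of Re f in direction v; v
    = 1 and v = i give the partial derivatives. *)
Definition dderive v c : nat -> R[i] := fun k => v * cderive c k.

Lemma tempered_dderive v c : tempered c -> tempered (dderive v c).
Proof. by move=> /tempered_derive/(tempered_mul v). Qed.

Lemma re_psum_dderive_bound c z : tempered c -> normc z < 1 ->
  exists2 B : R, 0 <= B & forall h, `|re_psum (dderive h c) z| <= B * normc h.
Proof.
move=> tc z1; have [|B [x [B0 x01 H]]] := tempered_decay (r := normc z) (tempered_derive tc).
  by rewrite normc_ge0.
exists (B / (1 - x)) => [|h].
  by have /andP[_ x1] := x01; rewrite divr_ge0// subr_ge0 ltW.
rewrite mulrAC; apply: (proj2 (geometric_dominated x01 _)) => k.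
apply: le_trans (normc_Re _) _; rewrite !Normc.normcM normcX.
have := ler_wpM2l (normc_ge0 h) (H k); rewrite Normc.normcM.
have -> : B * normc h * x ^+ k = normc h * (B * x ^+ k) by rewrite mulrCA mulrA.
by rewrite -[normc h * _ * _]mulrA.
Qed.

(** The increment is at most A n^2 + B n with n = |w - z|, and n^2 <= n once n < 1. *)
Lemma mcontinuous_re_psum c z : tempered c -> normc z < 1 -> mcontinuous (re_psum c) z.
Proof.
move=> tc z1 e e0; pose r := (1 + normc z) / 2.
have z0 := normc_ge0 z.
have r01 : 0 < r < 1 by rewrite /r; apply/andP; split; lra.
have [A A0 HA] := re_psum_taylor tc r01.
have [B B0 HB] := re_psum_dderive_bound tc z1.
have AB : 0 < A + B + 1 by rewrite ltr_wpDl// addr_ge0.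
exists (Num.min (Num.min 1 (r - normc z)) (e / (A + B + 1))).
  by rewrite !lt_min ltr01 divr_gt0// andbT /= /r; clear -z1; lra.
move=> w; rewrite !lt_min => /andP[/andP[w1 w2] w3].
have zr : normc z <= r by rewrite /r; lra.
have wr : normc (z + (w - z)) <= r.
  by apply: le_trans (le_normcD _ _) _; rewrite addrC -lerBrDr ltW.
have := HA _ _ zr wr; rewrite -/(dderive (w - z) c) subrKC => h1.
have h2 := HB (w - z).
set n := normc (w - z) in w1 w2 w3 h1 h2.
have n0 : 0 <= n by exact: normc_ge0.
have h3 : A * n ^+ 2 <= A * n.
  by apply: ler_wpM2l => //; rewrite expr2; apply: ler_piMr => //; exact: ltW.
have h4 : A * n + B * n + n < e.
  by move: w3; rewrite ltr_pdivlMr// mulrC !mulrDl mul1r.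
rewrite -[re_psum c w - _](subrK (re_psum (dderive (w - z) c) z)).
apply: le_lt_trans (ler_normD _ _) _; apply: le_lt_trans (lerD h1 h2) _.
apply: le_lt_trans h4; rewrite -addrA; apply: lerD => //.
by rewrite lerDl.
Qed.

Lemma re_psumZ c z (a : R) : tempered c -> normc z < 1 ->
  re_psum (fun k => a%:C * c k) z = a * re_psum c z.
Proof.
move=> tc z1; rewrite /re_psum -[RHS](lim_seriesZ a (re_psum_dominated tc z1)).
by congr (limn (series _)); apply/funext => k; rewrite /= -mulrA ReZ.
Qed.

Lemma is_derive_quadratic (g : R -> R) (a l A e : R) : 0 < e -> 0 <= A ->
  (forall s, `|s| < e -> `|g (a + s) - g a - s * l| <= A * s ^+ 2) ->
  is_derive a 1 g l.
Proof.
move=> e0 A0 H.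
suff cl : h^-1 *: ((g \o shift a) (h *: (1 : R)) - g a) @[h --> 0^'] --> l.
  by apply: DeriveDef; [exact: cvgP cl|exact: cvg_lim cl].
apply/cvgrPdist_lt => eps eps0; near=> h.
have h0 : h != 0 by near: h; exact: nbhs_dnbhs_neq.
have he : `|h| < e by near: h; exact: dnbhs0_lt.
have he2 : `|h| < eps / (A + 1) by near: h; apply: dnbhs0_lt; rewrite divr_gt0// ltr_wpDl.
have := H h he; rewrite /= /GRing.scale /= mulr1 [h + a]addrC => Hh.
have -> : l - h^-1 * (g (a + h) - g a) = - (h^-1 * (g (a + h) - g a - h * l)).
  by field.
have hp : 0 < `|h| by rewrite normr_gt0.
rewrite normrN normrM normfV mulrC ltr_pdivrMr//.
apply: (le_lt_trans Hh); rewrite -real_normK ?num_real// expr2 mulrA.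
rewrite ltr_pM2r//; move: he2; rewrite ltr_pdivlMr ?ltr_wpDl//.
by lra.
Unshelve. all: by end_near. Qed.

Lemma is_derive_re_psum c z v (g : R -> R) (a : R) :
  tempered c -> normc z < 1 -> normc v = 1 ->
  (forall s, g (a + s) = re_psum c (z + s%:C * v)) ->
  is_derive a 1 g (re_psum (dderive v c) z).
Proof.
move=> tc z1 v1 gE; pose r := (1 + normc z) / 2.
have z0 := normc_ge0 z.
have r01 : 0 < r < 1 by rewrite /r; apply/andP; split; lra.
have [A A0 HA] := re_psum_taylor tc r01.
apply: (@is_derive_quadratic _ _ _ A (r - normc z)) => //; first by rewrite /r; lra.
move=> s sr.
have nsv : normc (s%:C * v) = `|s| by rewrite Normc.normcM v1 mulr1 normc_real.
have zr : normc z <= r by rewrite /r; lra.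
have zsr : normc (z + s%:C * v) <= r.
  by apply: le_trans (le_normcD _ _) _; rewrite nsv addrC -lerBrDr ltW.
have ga : g a = re_psum c z by rewrite -[a]addr0 gE mul0r addr0.
have := HA _ _ zr zsr; rewrite gE ga nsv real_normK ?num_real//.
have -> : (fun k => s%:C * v * cderive c k) = fun k => s%:C * dderive v c k.
  by apply/funext => k; rewrite /dderive mulrA.
by rewrite re_psumZ//; exact: tempered_dderive.
Qed.

Lemma near_real (a d : R) (P : R -> Prop) : 0 < d ->
  (forall s, `|s - a| < d -> P s) -> \forall s \near a, P s.
Proof.
move=> d0 H; apply/nbhs_normP; exists d => // s /=.
by rewrite /ball_ /= distrC; exact: H.
Qed.

Lemma partials_re_psum c (f : R[i] -> R) z : tempered c ->
  (forall w, normc w < 1 -> f w = re_psum c w) -> normc z < 1 ->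
  is_derive (Re z) 1 (fun s : R => f (s +i* Im z)) (re_psum (dderive 1 c) z) /\
  is_derive (Im z) 1 (fun s : R => f (Re z +i* s)) (re_psum (dderive 'i%C c) z).
Proof.
move=> tc fE z1; have d0 : 0 < 1 - normc z by rewrite subr_gt0.
have near_z w : normc (w - z) < 1 - normc z -> re_psum c w = f w.
  by move=> wz; rewrite fE//; have := le_normcD (w - z) z; rewrite subrK; lra.
split.
- apply: (@near_eq_is_derive _ _ _ (fun s : R => re_psum c (s +i* Im z))).
    apply: (near_real d0) => s sz; apply: near_z.
    have -> : s +i* Im z - z = (s - Re z)%:C.
      by case: (z) => a b; apply/eqP; rewrite eq_complex /= subrr !eqxx.
    by rewrite normc_real.
  apply: (is_derive_re_psum tc z1); first exact: Normc.normc1.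
  move=> s; congr re_psum; case: (z) => a b.
  by apply/eqP; rewrite eq_complex /=; apply/andP; split; apply/eqP; ring.
- apply: (@near_eq_is_derive _ _ _ (fun s : R => re_psum c (Re z +i* s))).
    apply: (near_real d0) => s sz; apply: near_z.
    have -> : Re z +i* s - z = (s - Im z)%:C * 'i%C.
      by case: (z) => a b; apply/eqP; rewrite eq_complex /= subrr; apply/andP; split; apply/eqP; ring.
    by rewrite Normc.normcM normc_real /= expr0n expr1n add0r sqrtr1 mulr1.
  apply: (is_derive_re_psum tc z1); first by rewrite /= expr0n expr1n add0r sqrtr1.
  move=> s; congr re_psum; case: (z) => a b.
  by apply/eqP; rewrite eq_complex /=; apply/andP; split; apply/eqP; ring.
Qed.

(** Agreement of f with the series is required on the disk only, so the lemma applies again to the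
    partial derivatives themselves. *)
Lemma C1_re_psum c (f : R[i] -> R) : tempered c ->
  (forall w, normc w < 1 -> f w = re_psum c w) ->
  [/\ C1_on (@unit_disk R) f,
      forall w, normc w < 1 -> partial_x f w = re_psum (dderive 1 c) w
    & forall w, normc w < 1 -> partial_y f w = re_psum (dderive 'i%C c) w].
Proof.
move=> tc fE.
have px w : normc w < 1 -> partial_x f w = re_psum (dderive 1 c) w.
  by move=> w1; have [[_ E] _] := partials_re_psum tc fE w1; rewrite /partial_x derive1E.
have py w : normc w < 1 -> partial_y f w = re_psum (dderive 'i%C c) w.
  by move=> w1; have [_ [_ E]] := partials_re_psum tc fE w1; rewrite /partial_y derive1E.
split => // z /unit_diskE z1.
have [[dx _] [dy _]] := partials_re_psum tc fE z1.
have cont v (g : R[i] -> R) : (forall w, normc w < 1 -> g w = re_psum (dderive v c) w) ->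
    {for z, continuous (g : R[i]^o -> R)}.
  move=> gE; apply: mcontinuous_continuous => e.
  move=> /(mcontinuous_re_psum (tempered_dderive v tc) z1)[d d0 H].
  exists (Num.min d (1 - normc z)); first by rewrite lt_min d0 subr_gt0.
  move=> w; rewrite lt_min => /andP[wd wz]; rewrite !gE//; first exact: H.
  by have := le_normcD (w - z) z; rewrite subrK; lra.
by split; [exact: dx|exact: dy|exact: cont px|exact: cont py].
Qed.

(** The second partial derivatives are Re f'' and Re (i^2 f''), which cancel. *)
Lemma harmonic_re_psum c (f : R[i] -> R) : tempered c ->
  (forall w, normc w < 1 -> f w = re_psum c w) -> harmonic_on (@unit_disk R) f.
Proof.
move=> tc fE; have [C1f px py] := C1_re_psum tc fE.
have tx := tempered_dderive 1 tc; have ty := tempered_dderive 'i%C tc.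
have [C1x pxx _] := C1_re_psum tx px.
have [C1y _ pyy] := C1_re_psum ty py.
split; first by split.
move=> z /unit_diskE z1; rewrite pxx// pyy//.
have cx := re_psum_dominated (tempered_dderive 1 tx) z1.
rewrite addrC; apply/eqP; rewrite addr_eq0; apply/eqP.
rewrite /re_psum -[RHS](lim_seriesN cx); congr (limn (series _)).
apply/funext => k; rewrite /= fctE -ReN; congr Re.
by rewrite /dderive /cderive; have := sqr_i R; rewrite expr2 => ii; ring: ii.
Qed.

End Harmonicity.

(** * Convergence of bounded sequences along an ultrafilter *)

Section Compactness.
Variable R : realType.

(** Compactness of the segment gives a cluster point, and an ultrafilter converges to its cluster
    points. *)
Lemma ultra_cvg_bounded (U : set_system nat) (x : nat -> R) (B : R) :
  UltraFilter U -> (forall n, `|x n| <= B) ->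
  exists2 l : R, `|l| <= B & x @ U --> l.
Proof.
move=> UU xB.
have UB : U (x @^-1` `[- B, B]).
  by apply: filterE => n; rewrite /= in_itv /= -ler_norml.
have [l [/=]] := @segment_compact R (- B) B (x @ U) _ UB.
rewrite in_itv /= -ler_norml => lB cl; exists l => // V Vl.
have [//|UV] := in_ultra_setVsetC (x @^-1` V) UU.
by have [y [/= nVy Vy]] := cl (~` V) V UV Vl.
Qed.

End Compactness.

(** * The limit of the harmonic polynomials *)

Section Limit.
Variable R : realType.
Implicit Types (z w : R[i]) (c : nat -> R[i]).

Lemma exists_expr_le (x y : R) : 0 <= x < 1 -> 0 < y -> exists n, x ^+ n <= y.
Proof.
move=> /andP[x0 x1] y0.
have : GRing.exp x @ \oo --> (0 : R) by apply: cvg_expr; rewrite ger0_norm.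
move=> /cvgrPdist_le/(_ _ y0)[n _ H]; exists n.
by have := H n (leqnn n); rewrite /= sub0r normrN ger0_norm// exprn_ge0.
Qed.

Lemma near_forall_lt (U : set_system nat) (P : nat -> nat -> Prop) n :
  Filter U -> (forall k, \forall N \near U, P k N) ->
  \forall N \near U, forall k, (k < n)%N -> P k N.
Proof.
move=> FU HP; elim: n => [|n IH]; first by near=> N.
near=> N => k; rewrite ltnS leq_eqVlt => /predU1P[->|kn]; first by near: N.
by move: k kn; near: N.
Unshelve. all: by end_near. Qed.

Lemma re_psum_finite c z n : (forall k, (n <= k)%N -> c k = 0) ->
  re_psum c z = \sum_(k < n) Re (c k * z ^+ k).
Proof.
move=> c0; apply: lim_near_cst => //; near=> m.
rewrite /series /= (big_cat_nat (leq0n n))/=; last by near: m; exact: nbhs_infty_ge.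
rewrite big_mkord [X in _ + X]big_nat_cond [X in _ + X]big1 ?addr0// => k /andP[/andP[nk _] _].
by rewrite c0// mul0r.
Unshelve. all: by end_near. Qed.

(** The terms of the difference are at most eta s^k: below n by closeness of the coefficients, from
    n on because B r^k = B (r / s)^k s^k. *)
Lemma re_psum_close c1 c2 z (r s eta B : R) n :
  tempered c1 -> tempered c2 -> normc z <= r -> r < s < 1 -> 0 <= B ->
  B * (r / s) ^+ n <= eta ->
  (forall k, (k < n)%N -> normc (c1 k - c2 k) <= eta) ->
  (forall k, normc (c1 k - c2 k) <= B) ->
  `|re_psum c1 z - re_psum c2 z| <= eta / (1 - s).
Proof.
move=> t1 t2 zr /andP[rs s1] B0 Bn small bnd.
have z0 := normc_ge0 z; have r0 := le_trans z0 zr.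
have s0 := le_lt_trans r0 rs.
have z1 : normc z < 1 by apply: le_lt_trans zr (lt_trans rs s1).
rewrite /re_psum -(lim_seriesB (re_psum_dominated t1 z1) (re_psum_dominated t2 z1)).
have s01 : 0 <= s < 1 by rewrite s1 ltW.
apply: (proj2 (geometric_dominated s01 _)) => k.
rewrite !fctE -ReB -mulrBl; apply: le_trans (normc_Re _) _.
rewrite Normc.normcM normcX.
have zk : normc z ^+ k <= r ^+ k by rewrite lerXn2r ?nnegrE.
have eta0 : 0 <= eta.
  by apply: le_trans Bn; rewrite mulr_ge0// exprn_ge0// divr_ge0// ltW.
have [kn|nk] := ltnP k n.
  apply: ler_pM; rewrite ?normc_ge0 ?exprn_ge0//; first exact: small.
  by rewrite lerXn2r ?nnegrE ?(ltW s0)//; exact: le_trans zr (ltW rs).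
apply: (@le_trans _ _ (B * r ^+ k)).
  by apply: ler_pM; rewrite ?normc_ge0 ?exprn_ge0.
have -> : r ^+ k = (r / s) ^+ k * s ^+ k by rewrite -exprMn divfK// gt_eqF.
rewrite mulrA; apply: ler_wpM2r; first by rewrite exprn_ge0// ltW.
apply: le_trans Bn; apply: ler_wpM2l => //; apply: ler_wiXn2l => //.
  by rewrite divr_ge0// ltW.
by rewrite ler_pdivrMr// mul1r ltW.
Qed.

(** Bounded coefficients converge one by one along an ultrafilter, and [re_psum_close] passes this
    to the values. Convergence along an ultrafilter yields some N beyond any N0, which suffices
    against a bound valid for all large N. *)
Lemma limit_coefficients (q : nat -> {poly R[i]}) (M : R) :
  (forall N z, normc z = 1 -> 0 <= Re (q N).[z]) ->
  (forall N, Re (q N)`_0 <= M) ->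
  exists2 c, tempered c & forall z (e : R) N0, normc z < 1 -> 0 < e ->
    exists2 N, (N0 <= N)%N & Re (q N).[z] <= re_psum c z + e.
Proof.
move=> q0 qM.
(* Im (q N)`_0 is not controlled, but does not contribute to Re (q N). *)
pose a N k := if k is 0%N then (Re (q N)`_0)%:C else (q N)`_k.
have c00 N : 0 <= Re (q N)`_0.
  have := coef_bound (q0 N) (ltn0Sn 0); rewrite -[0 <= _](pmulr_rge0 _ (ltr0n R 2)).
  by apply: le_trans; exact: normc_ge0.
have M0 : 0 <= M := le_trans (c00 0%N) (qM 0%N).
have aB N k : normc (a N k) <= 2 * M.
  case: k => [|k]; last first.
    by apply: le_trans (coef_bound (q0 N) (ltn0Sn k)) _; rewrite ler_pM2l.
  by rewrite normc_real ger0_norm// (le_trans (qM N))// ler_peMl// ler1n.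
have aE N z : re_psum (a N) z = Re (q N).[z].
  rewrite (@re_psum_finite _ _ (size (q N)).+1).
    rewrite (horner_coef_wide z (leqnSn _)) Re_sum; apply: eq_bigr => -[[|k] ?] _ //=.
    by rewrite !expr0 !mulr1 mulr0 subr0.
  by move=> [//|k] /ltnW kq; rewrite /a nth_default.
(* The ultrafilter refines the filter of cofinite tails, so it contains every set N >= N0. *)
have [U [UU sU]] := ultraFilterLemma eventually_filter.
have cvr k : exists l : R, `|l| <= 2 * M /\ (fun N => Re (a N k)) @ U --> l.
  have [|l] := @ultra_cvg_bounded _ U (fun N => Re (a N k)) (2 * M) UU.
    by move=> N; apply: le_trans (normc_Re _) (aB N k).
  by exists l.
have cvi k : exists l : R, `|l| <= 2 * M /\ (fun N => Im (a N k)) @ U --> l.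
  have [|l] := @ultra_cvg_bounded _ U (fun N => Im (a N k)) (2 * M) UU.
    by move=> N; apply: le_trans (normc_Im _) (aB N k).
  by exists l.
have [cr crP] := choice cvr; have [ci ciP] := choice cvi.
pose c k := cr k +i* ci k.
have cB k : normc (c k) <= 4 * M.
  apply: le_trans (normc_le_ReIm _) _ => /=.
  by have [h1 _] := crP k; have [h2 _] := ciP k; lra.
have tc : tempered c by exact: bounded_tempered cB.
exists c => // z e N0 z1 e0.
pose r := normc z; pose s := (1 + r) / 2.
have r0 : 0 <= r by exact: normc_ge0.
have r1 : r < 1 by [].
have [s0 s1 rs] : [/\ 0 < s, s < 1 & r < s] by rewrite /s; split; lra.
pose eta := e * (1 - s).
have eta0 : 0 < eta by rewrite mulr_gt0// subr_gt0.
(* The coefficients differ by at most 2 M + 4 M; the added 1 keeps the divisor positive when M =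
   0. *)
have [||n Hn] := @exists_expr_le (r / s) (eta / (6 * M + 1)).
- by rewrite divr_ge0 ?(ltW s0)//= ltr_pdivrMr// mul1r.
- by rewrite divr_gt0// ltr_wpDl// mulr_ge0.
have eta2 : 0 < eta / 2 by rewrite divr_gt0.
have HN : \forall N \near U, forall k, (k < n)%N -> normc (a N k - c k) <= eta.
  apply: near_forall_lt => k.
  have [_ h1] := crP k; have [_ h2] := ciP k.
  near=> N; apply: le_trans (normc_le_ReIm _) _; rewrite ReB ImB /=.
  rewrite (splitr eta); apply: lerD; rewrite distrC; near: N.
    by move/cvgrPdist_le: h1; exact.
  by move/cvgrPdist_le: h2; exact.
have HN0 : \forall N \near U, (N0 <= N)%N by apply: sU; exact: nbhs_infty_ge.
have [N [HNN NN0]] := filter_ex (filterI HN HN0).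
exists N => //.
have ta : tempered (a N) by exact: bounded_tempered (aB N).
have := @re_psum_close (a N) c z r s eta (6 * M) n ta tc.
rewrite /r s1 rs aE => /(_ (lexx _) isT).
have -> : eta / (1 - s) = e by rewrite /eta mulfK// subr_eq0 gt_eqF.
move=> H; suff : `|Re (q N).[z] - re_psum c z| <= e.
  by rewrite ler_norml => /andP[_]; lra.
apply: H => //; first by rewrite mulr_ge0.
  have M1 : 0 < 6 * M + 1 by rewrite ltr_wpDl// mulr_ge0.
  move: Hn; rewrite ler_pdivlMr// => Hn; apply: le_trans Hn.
  rewrite mulrC; apply: ler_wpM2l; last by rewrite lerDl.
  by rewrite exprn_ge0// divr_ge0// ltW.
move=> k; apply: le_trans (le_normcD _ _) _; rewrite normcN.
by have := aB N k; have := cB k; lra.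
Unshelve. all: by end_near. Qed.

End Limit.

Theorem theorem1 (R : realType) (phi : R[i] -> R) (C : R)
    (phi_ge0 : forall z : R[i], unit_disk z -> 0 <= phi z)
    (C_ge2 : 2 <= C)
    (hu : exists u : R[i] -> R,
        [/\ forall z : R[i], unit_disk z -> 0 < u z,
            superharmonic_on (@unit_disk R) (fun z : R[i] => (u z)%:E),
            log_lipschitz C u
          & forall z : R[i], unit_disk z -> phi z <= u z]) :
  exists h : R[i] -> R,
    [/\ forall z : R[i], unit_disk z -> 0 < h z,
        harmonic_on (@unit_disk R) h
      & forall z : R[i], unit_disk z -> phi z <= h z].
Proof.
have [u [u_gt0 [_ _ _ u_mean] u_lip u_ge]] := hu.
have C0 : 0 <= C by apply: le_trans C_ge2.
have [K [M [q [K0 q0 qM uq]]]] := harmonic_polynomials C0 u_gt0 u_lip u_mean.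
have [c tc cq] := limit_coefficients q0 qM.
have tKc := tempered_mul K%:C tc.
have u_le z : unit_disk z -> u z <= re_psum (fun k => K%:C * c k) z.
  move=> /unit_diskE z1; rewrite re_psumZ//.
  have [N0 HN0] := uq z z1.
  apply/ler_addgt0Pr => e e0.
  (* The error e / K becomes e after multiplication by K. Since u > 0, the resulting inequality also
     gives positivity of the majorant. *)
  have [N NN0 HN] := cq z (e / K) N0 z1 (divr_gt0 e0 K0).
  apply: le_trans (HN0 N NN0) _.
  apply: (@le_trans _ _ (K * (re_psum c z + e / K))); first by rewrite ler_pM2l.
  by rewrite mulrDr [K * (e / K)]mulrC divfK// gt_eqF.
exists (re_psum (fun k => K%:C * c k)); split.
- by move=> z Dz; apply: lt_le_trans (u_gt0 z Dz) (u_le z Dz).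
- exact: (harmonic_re_psum tKc).
- by move=> z Dz; apply: le_trans (u_ge z Dz) (u_le z Dz).
Qed.
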